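(* Let $X$ be a complex Banach space, $\tau>0$, let $A_{0}:\mathcal{D}(A_{0})\subseteq X\to X$ be the infinitesimal generator of a strongly continuous semigroup $\{\mathcal{T}(t)\}_{t\ge 0}$ of bounded linear operators, $A_{1}\in\mathcal{L}(X)$, and let the initial function $\varphi\in C^{1}([-\tau,0],X)$ satisfy $\varphi(t)\in\mathcal{D}(A_{0})$ for all $t\in[-\tau,0]$. Then the classical (strong) solution $u_{0}\in C^{1}([-\tau,\infty),X)$ of the abstract Cauchy problem $$\frac{\mathrm{d}}{\mathrm{d}t}u(t)=A_{0}u(t)+A_{1}u(t-\tau),\ t\ge 0,\qquad u(t)=\varphi(t),\ -\tau\le t\le 0,$$ satisfies $u_{0}(t)\in\mathcal{D}(A_{0})$ for all $t\ge 0$ and can be represented in the integral form $$u_{0}(t)=\mathcal{S}(t+\tau;\tau)\varphi(-\tau)+\int_{-\tau}^{0}\mathcal{S}(t-s;\tau)\big[\varphi'(s)-A_{0}\varphi(s)\big]\mathrm{d}s,\quad t\ge -\tau,$$ where $\mathcal{S}(\cdot;\tau)$ is the fundamental solution of the equation.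
   Context: A classical (strong) solution of the Cauchy problem is a function $u:[-\tau,\infty)\to X$ that is continuous on $[-\tau,\infty)$, continuously differentiable on $[0,\infty)$, with $u(t)\in\mathcal{D}(A_{0})$ for all $t\ge 0$ (where $\varphi(0)\in\mathcal{D}(A_0)$), satisfying the problem for all $t\ge 0$. The fundamental solution $\mathcal{S}(\cdot;\tau)$ with values in $\mathcal{L}(X)$ is the operator family satisfying $\frac{\mathrm{d}}{\mathrm{d}t}\mathcal{S}(t;\tau)=A_{0}\mathcal{S}(t;\tau)+A_{1}\mathcal{S}(t-\tau;\tau)$ for $t\ge 0$, with $\mathcal{S}(t;\tau)=\Theta$ (zero operator) for $t<0$ and $\mathcal{S}(0;\tau)=I$; it is given explicitly by $\mathcal{S}(t;\tau)=\sum_{n\ge 0}S_{n}(t,n\tau)\mathbf{1}_{t\ge n\tau}$ for $t\ge 0$, where $\mathbf{1}_{t\ge n\tau}$ is $1$ if $t\ge n\tau$ and $0$ otherwise, $S_{0}(t,0)=\mathcal{T}(t)$ and $S_{n}(t,n\tau)=\int_{n\tau}^{t}\mathcal{T}(t-s)A_{1}S_{n-1}(s-\tau,(n-1)\tau)\,\mathrm{d}s$ for $t\ge n\tau$, $n\in\mathbb{N}$ (integrals in the strong operator topology).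
   Formalization: $u_0\in C^1([-\tau,\infty),X)$ fails in general; proved: $u_0$ continuous on $[-\tau,\infty)$, $C^1$ on $[0,\infty)$, and $C^1$ on $[-\tau,\infty)$ iff $\varphi'(0)=A_0\varphi(0)+A_1\varphi(-\tau)$. The integral is Henstock–Kurzweil, as $A_0\varphi$ need not be Bochner integrable. *)

(* Defs.v *)
From Stdlib Require Import Reals Lra Lia Classical.
From Coquelicot Require Import Coquelicot.
Open Scope R_scope.

(** * Restriction of scalars

    Coquelicot's calculus of functions of a real variable ([filterdiff] with
    real increments, [RInt], [Riemann_sum]) lives in normed modules over
    [R_AbsRing].  [realify X] is the complex Banach space [X] with its own
    group, norm and topology, and with [scal] restricted to real scalars. *)

Section Realify.

Context (X : CompleteNormedModule C_AbsRing).

Definition rscal (r : R) (x : X) : X :=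
  @scal C_AbsRing X (RtoC r) x.

Lemma rscal_assoc (a b : R) (x : X) :
  rscal a (rscal b x) = rscal (mult a b) x.
Proof.
unfold rscal; rewrite scal_assoc; f_equal; symmetry; apply RtoC_mult.
Qed.

Lemma rscal_one (x : X) : rscal one x = x.
Proof. exact (@scal_one C_AbsRing X x). Qed.

Lemma rscal_distr_l (a : R) (x y : X) :
  rscal a (plus x y) = plus (rscal a x) (rscal a y).
Proof. exact (@scal_distr_l C_AbsRing X (RtoC a) x y). Qed.

Lemma rscal_distr_r (a b : R) (x : X) :
  rscal (plus a b) x = plus (rscal a x) (rscal b x).
Proof.
unfold rscal.
change (@scal C_AbsRing X (RtoC (a + b)) x =
  plus (@scal C_AbsRing X (RtoC a) x) (@scal C_AbsRing X (RtoC b) x)).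
rewrite RtoC_plus; exact (@scal_distr_r C_AbsRing X (RtoC a) (RtoC b) x).
Qed.

Lemma norm_rscal (a : R) (x : X) : norm (rscal a x) <= abs a * norm x.
Proof.
eapply Rle_trans; [exact (@norm_scal C_AbsRing X (RtoC a) x)|].
change (Cmod (RtoC a) * norm x <= Rabs a * norm x).
rewrite Cmod_R; apply Rle_refl.
Qed.

Definition realify_ModuleSpace_mixin : ModuleSpace.mixin_of R_Ring X :=
  ModuleSpace.Mixin R_Ring X rscal
    rscal_assoc rscal_one rscal_distr_l rscal_distr_r.

Definition realify_NormedModuleAux : NormedModuleAux R_AbsRing :=
  NormedModuleAux.Pack R_AbsRing X
    (NormedModuleAux.Class R_AbsRing X
       (ModuleSpace.Class R_Ring X
          (AbelianGroup.class X) realify_ModuleSpace_mixin)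
       (UniformSpace.class X))
    X.

Definition realify_NormedModule_mixin :
  NormedModule.mixin_of R_AbsRing realify_NormedModuleAux :=
  NormedModule.Mixin R_AbsRing realify_NormedModuleAux
    (@norm C_AbsRing X) (@norm_factor C_AbsRing X)
    norm_triangle norm_rscal norm_compat1 norm_compat2 norm_eq_zero.

Definition realify : CompleteNormedModule R_AbsRing :=
  CompleteNormedModule.Pack R_AbsRing X
    (CompleteNormedModule.Class R_AbsRing X
       (NormedModule.Class R_AbsRing X
          (NormedModuleAux.class R_AbsRing realify_NormedModuleAux)
          realify_NormedModule_mixin)
       (CompleteSpace.class X))
    X.

End Realify.

(** * Differentiability relative to a set *)

(** One-sided at those endpoints of an interval [D] that belong to [D]. *)
Definition is_derive_within {V : NormedModule R_AbsRing}
    (D : R -> Prop) (f : R -> V) (t : R) (l : V) : Prop :=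
  filterdiff f (within D (locally t)) (fun h : R => scal h l).

Definition C1_on {V : NormedModule R_AbsRing}
    (D : R -> Prop) (f df : R -> V) : Prop :=
  (forall t, D t -> is_derive_within D f t (df t)) /\ continuous_on D df.

(** * The Henstock-Kurzweil integral

    Same Riemann sums and same shape as [is_RInt], but the mesh is controlled
    by a gauge [delta] that may depend on the tag.  This integral extends both
    the Riemann and the Bochner integral, with the same value.  It is used for
    integrands involving [A0 (phi s)], which need be neither continuous nor
    Bochner integrable when [phi] is merely C^1 with values in the domain. *)

Definition gauge_fine (delta : R -> posreal) (ptd : @SF_seq R) : Prop :=
  forall i, (i < SF_size ptd)%nat ->
    let xi := seq.nth 0 (SF_ly ptd) i in
    xi - delta xi < seq.nth 0 (SF_lx ptd) i /\
    seq.nth 0 (SF_lx ptd) (S i) < xi + delta xi.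

Definition HK_fine (a b : R) : (@SF_seq R -> Prop) -> Prop :=
  fun P => exists delta : R -> posreal, forall ptd : @SF_seq R,
    pointed_subdiv ptd -> gauge_fine delta ptd ->
    SF_h ptd = Rmin a b -> seq.last (SF_h ptd) (SF_lx ptd) = Rmax a b ->
    P ptd.

Definition is_HKInt {V : NormedModule R_AbsRing}
    (f : R -> V) (a b : R) (If : V) : Prop :=
  filterlim (fun ptd => scal (sign (b - a)) (Riemann_sum f ptd))
    (HK_fine a b) (locally If).

Lemma HK_fine_filter (a b : R) : Filter (HK_fine a b).
Proof.
constructor.
- exists (fun _ => mkposreal 1 Rlt_0_1); auto.
- intros P Q [d1 H1] [d2 H2].
  exists (fun x => mkposreal _ (Rmin_stable_in_posreal (d1 x) (d2 x))).
  intros ptd Hp Hg Hh Hl; split; [apply H1|apply H2]; trivial; intros i Hi;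
    destruct (Hg i Hi) as [G1 G2]; cbn in G1, G2 |- *;
    set (xi := seq.nth 0 (SF_ly ptd) i) in *.
  + pose proof (Rmin_l (d1 xi) (d2 xi)); lra.
  + pose proof (Rmin_r (d1 xi) (d2 xi)); lra.
- intros P Q HPQ [d H]; exists d; auto.
Qed.

(** Cousin's lemma. *)
Lemma gauge_fine_ex (delta : R -> posreal) (a b : R) : a <= b ->
  exists ptd : @SF_seq R, pointed_subdiv ptd /\ gauge_fine delta ptd /\
    SF_h ptd = a /\ seq.last (SF_h ptd) (SF_lx ptd) = b.
Proof.
intros Hab.
pose (G := fun x (ptd : @SF_seq R) => pointed_subdiv ptd /\
  gauge_fine delta ptd /\ SF_h ptd = x /\
  seq.last (SF_h ptd) (SF_lx ptd) = b).
pose (E := fun y => 0 <= y <= b - a /\ exists ptd, G (b - y) ptd).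
assert (Hcons : forall x x' c ptd, G x ptd -> x' <= c <= x ->
          c - delta c < x' -> x < c + delta c ->
          G x' (mkSF_seq x' (cons (x, c) (SF_t ptd)))).
{ intros x x' c [h t] (Hp & Hg & Hh & Hl) Hc H1 H2; cbn in Hh; subst h.
  split; [|split; [|split]].
  - intros [|i] Hi; [cbn; lra|]; apply (Hp i); cbn in *; lia.
  - intros [|i] Hi; [cbn; lra|]; apply (Hg i); cbn in *; lia.
  - reflexivity.
  - exact Hl. }
assert (E0 : E 0).
{ split; [lra|]; exists (mkSF_seq b nil); unfold G; rewrite Rminus_0_r.
  split; [|split; [|split]]; try reflexivity; intros i Hi; cbn in Hi; lia. }
destruct (completeness E) as [m [Hub Hlub]].
- exists (b - a); intros y [Hy _]; apply Hy.
- now exists 0.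
- assert (Hm : 0 <= m <= b - a).
  { split; [now apply Hub|apply Hlub; intros y [Hy _]; lra]. }
  assert (exists c, c = b - m) as [c Hceq] by now exists (b - m).
  assert (Hy : exists y, E y /\ m - delta c < y).
  { apply NNPP; intros Hn.
    assert (m <= m - delta c).
    { apply Hlub; intros y Hy; apply Rnot_lt_le; intros Hlt; apply Hn.
      now exists y. }
    pose proof (cond_pos (delta c)); lra. }
  destruct Hy as (y & HEy & Hym).
  pose proof (Hub y HEy) as Hym'; destruct HEy as (Hy & ptd & Hptd).
  pose proof (cond_pos (delta c)) as Hd.
  set (c' := Rmax a (c - delta c / 2)).
  assert (Hc' : c' <= c) by (apply Rmax_lub; lra).
  pose proof (Rmax_l a (c - delta c / 2)) as Hl1.
  pose proof (Rmax_r a (c - delta c / 2)) as Hl2.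
  fold c' in Hl1, Hl2.
  assert (HG : G c' (mkSF_seq c' (cons (b - y, c) (SF_t ptd)))).
  { apply Hcons; trivial; lra. }
  assert (Hca : c' = a).
  { destruct (Rle_lt_dec (c - delta c / 2) a) as [Hle|Hlt];
      [now apply Rmax_left|exfalso].
    assert (Heq : c' = c - delta c / 2) by (apply Rmax_right; lra).
    assert (H : E (b - c')).
    { split; [lra|]; eexists.
      replace (b - (b - c')) with c' by ring; exact HG. }
    apply Hub in H; lra. }
  rewrite Hca in HG; eexists; exact HG.
Qed.

#[global] Instance HK_fine_proper_filter (a b : R) :
  ProperFilter (HK_fine a b).
Proof.
constructor; [|apply HK_fine_filter].
intros P [delta H].
destruct (gauge_fine_ex delta (Rmin a b) (Rmax a b)) as (ptd & ? & ? & ? & ?).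
- apply Rle_trans with a; [apply Rmin_l|apply Rmax_l].
- exists ptd; auto.
Qed.

Lemma is_HKInt_unique {V : NormedModule R_AbsRing} (f : R -> V) (a b : R)
    (I J : V) : is_HKInt f a b I -> is_HKInt f a b J -> I = J.
Proof.
intros HI HJ; apply eq_close.
exact (filterlim_locally_close (F := HK_fine a b) _ _ _ HI HJ).
Qed.

Lemma is_HKInt_RInt {V : NormedModule R_AbsRing} (f : R -> V) (a b : R)
    (I : V) : is_RInt f a b I -> is_HKInt f a b I.
Proof.
intros HI; refine (filterlim_filter_le_1 _ _ HI).
intros P [eps HP]; exists (fun _ => pos_div_2 eps).
intros ptd Hp Hg Hh Hl; apply HP; [|now auto].
cut (forall (t : list (R * R)) (h : R), pointed_subdiv (mkSF_seq h t) ->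
      gauge_fine (fun _ => pos_div_2 eps) (mkSF_seq h t) ->
      seq_step (SF_lx (mkSF_seq h t)) < eps).
{ destruct ptd as [h t]; intros H; now apply H. }
clear; intros t; induction t as [|[x c] t IH]; intros h Hp Hg.
- apply cond_pos.
- unfold seq_step; cbn; apply Rmax_lub_lt.
  + destruct (Hg 0%nat) as [G1 G2]; [cbn; lia|].
    assert (Hp0 := Hp 0%nat ltac:(cbn; lia)); cbn in Hp0, G1, G2.
    unfold abs; cbn; rewrite Rabs_pos_eq; lra.
  + apply IH; intros i Hi; [apply (Hp (S i))|apply (Hg (S i))]; cbn in *; lia.
Qed.

(** * Semigroups and generators *)

(** Operators of the semigroup are only constrained at times [t >= 0];
    [is_linear] means linear and bounded. *)
Definition is_C0_semigroup {X : CompleteNormedModule C_AbsRing}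
    (T : R -> X -> X) : Prop :=
  (forall t, 0 <= t -> is_linear (T t)) /\
  (forall x, T 0 x = x) /\
  (forall t s x, 0 <= t -> 0 <= s -> T (t + s) x = T t (T s x)) /\
  (forall x, filterlim (fun t => T t x) (at_right 0) (locally x)).

(** The unbounded operator [A0 : D0 -> X] is given by its domain [D0] and by a
    total function whose values outside [D0] are irrelevant. *)
Definition is_generator {X : CompleteNormedModule C_AbsRing}
    (T : R -> X -> X) (D0 : X -> Prop) (A0 : X -> X) : Prop :=
  forall x y, (D0 x /\ A0 x = y) <->
    filterlim (fun h => scal (V := realify X) (/ h) (minus (T h x) x))
      (at_right 0) (locally y).

(** * The delay equation *)

Definition classical_solution {X : CompleteNormedModule C_AbsRing}
    (D0 : X -> Prop) (A0 A1 : X -> X) (tau : R) (phi u : R -> X) : Prop :=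
  continuous_on (fun t => - tau <= t) u /\
  (exists du : R -> X,
     C1_on (V := realify X) (fun t => 0 <= t) u du /\
     forall t, 0 <= t ->
       D0 (u t) /\ du t = plus (A0 (u t)) (A1 (u (t - tau)))) /\
  (forall t, - tau <= t <= 0 -> u t = phi t).

(** [fund_term T A1 tau n t] is $S_n(t, n\tau)$, meaningful for
    [INR n * tau <= t]; strong integrals are taken vector by vector. *)
Fixpoint fund_term {X : CompleteNormedModule C_AbsRing}
    (T : R -> X -> X) (A1 : X -> X) (tau : R) (n : nat) (t : R) (x : X) : X :=
  match n with
  | O => T t x
  | S m => RInt (V := realify X)
             (fun s => T (t - s) (A1 (fund_term T A1 tau m (s - tau) x)))
             (INR n * tau) t
  end.

(** The series has finitely many nonzero terms; [iota] picks its sum. *)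
Definition fund_sol {X : CompleteNormedModule C_AbsRing}
    (T : R -> X -> X) (A1 : X -> X) (tau t : R) (x : X) : X :=
  if Rlt_dec t 0 then zero
  else iota (is_series (fun n : nat =>
         if Rle_dec (INR n * tau) t then fund_term T A1 tau n t x else zero)).

(* Main.v *)
Require Import Defs.
From Stdlib Require Import Reals Lra Lia ZArith Classical List IndefiniteDescription
  FunctionalExtensionality.
From Coquelicot Require Import Coquelicot.
Open Scope R_scope.

(** The variation of constants formula is obtained by differentiating
    [s |-> S(t - s) u(s)], where [S] is the fundamental solution and [u] any
    classical solution.  The shifted terms [V_n(r) = S_n(r + n tau, n tau)] are
    the Dyson-Phillips iterates of the semigroup; on the domain of [A0] they
    satisfy [V_n' x = V_n (A0 x) + V_(n-1) (A1 x)], so that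
    [S'(r) x = S(r) A0 x + S(r - tau) A1 x] except at [r = 0, tau, 2 tau, ...].
    On [[-tau, 0]] the derivative is therefore
    [S(t - s) (phi'(s) - A0 phi(s)) - S(t - tau - s) A1 phi(s)] off a finite
    set, which the Henstock-Kurzweil fundamental theorem of calculus
    integrates without any regularity of [A0 phi].  On [[0, t]] the equation
    leaves the difference of [S(t - tau - s) A1 u(s)] and its translate by
    [tau], whose integral telescopes to the integral over [[-tau, 0]].  The
    formula only involves [phi], so it also gives uniqueness; existence is the
    method of steps. *)

(** * Linear combinations in a module *)

(** The obstacle is that [A0 phi] is controlled only pointwise: each [phi s] lies in the domain, so
    [s |-> S(t - s) phi(s)] has a derivative at each [s] off the jump times, and the integrability
    of that derivative must be a conclusion. [S] jumps from zero to the identity at time 0, so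
    [S(t - s) u(s)] breaks at [s = t]. It is replaced by a continuous function that is frozen at
    [u(t)] for [s >= t]; its derivative there is zero, as the formula demands of an [S] vanishing at
    negative times. Extending to negative times is used throughout: orbits and iterates become
    families on the whole line, and derivatives become two-sided. For a fixed [t] only finitely many
    terms of the series are active, so the calculus is done with a partial sum of order [N] where
    [t + tau < (N + 1) tau]. Convolutions are differentiated through their argument function, since
    the operators are merely strongly continuous; membership in the domain of [A0] is then read off
    from the derivative. Everything takes place in a real Banach space [Y] and is applied to
    [realify X]. *)

Inductive mexp : Type :=
| MVar (n : nat) | MZero | MPlus (a b : mexp) | MOpp (a : mexp)
| MScal (r : R) (a : mexp).

Section ModuleEquations.

Context {V : ModuleSpace R_Ring}.

Fixpoint meval (env : list V) (e : mexp) : V :=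
  match e with
  | MVar n => nth n env zero
  | MZero => zero
  | MPlus a b => plus (meval env a) (meval env b)
  | MOpp a => opp (meval env a)
  | MScal r a => scal r (meval env a)
  end.

Fixpoint mcoef (e : mexp) (n : nat) : R :=
  match e with
  | MVar m => if Nat.eqb m n then 1 else 0
  | MZero => 0
  | MPlus a b => mcoef a n + mcoef b n
  | MOpp a => - mcoef a n
  | MScal r a => r * mcoef a n
  end.

Fixpoint mlin (env : list V) (c : nat -> R) : V :=
  match env with
  | nil => zero
  | cons x env' => plus (scal (c 0%nat) x) (mlin env' (fun n => c (S n)))
  end.

Fixpoint mlin_eq (env : list V) (c d : nat -> R) : Prop :=
  match env with
  | nil => True
  | cons _ env' =>
      c 0%nat = d 0%nat /\ mlin_eq env' (fun n => c (S n)) (fun n => d (S n))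
  end.

Lemma mlin_ext (env : list V) (c d : nat -> R) :
  mlin_eq env c d -> mlin env c = mlin env d.
Proof.
revert c d; induction env as [|x env IH]; intros c d; cbn; [easy|].
intros [-> H]; now rewrite (IH _ _ H).
Qed.

Lemma mlin_zero (env : list V) : mlin env (fun _ => 0) = zero.
Proof.
induction env as [|x env IH]; cbn; [easy|].
rewrite IH, plus_zero_r; exact (scal_zero_l x).
Qed.

Lemma mlin_plus (env : list V) (c d : nat -> R) :
  mlin env (fun n => c n + d n) = plus (mlin env c) (mlin env d).
Proof.
revert c d; induction env as [|x env IH]; intros c d; cbn.
- now rewrite plus_zero_l.
- rewrite IH.
  replace (scal (c 0%nat + d 0%nat) x)
    with (plus (scal (c 0%nat) x) (scal (d 0%nat) x))
    by (symmetry; exact (scal_distr_r (c 0%nat) (d 0%nat) x)).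
  rewrite <- !plus_assoc; f_equal.
  rewrite !plus_assoc; f_equal; apply plus_comm.
Qed.

Lemma mlin_scal (env : list V) (r : R) (c : nat -> R) :
  mlin env (fun n => r * c n) = scal r (mlin env c).
Proof.
revert c; induction env as [|x env IH]; intros c; cbn.
- symmetry; exact (scal_zero_r r).
- rewrite IH; etransitivity; [|symmetry; exact (scal_distr_l r _ _)].
  f_equal; symmetry; exact (scal_assoc r (c 0%nat) x).
Qed.

Lemma mlin_opp (env : list V) (c : nat -> R) :
  mlin env (fun n => - c n) = opp (mlin env c).
Proof.
transitivity (scal (-1) (mlin env c)).
- rewrite <- mlin_scal; apply mlin_ext; generalize c; clear c.
  induction env; intros c; cbn; [easy|]; split; [ring|apply (IHenv (fun n => c (S n)))].
- exact (scal_opp_one (mlin env c)).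
Qed.

Lemma mlin_var (env : list V) (m : nat) :
  mlin env (fun n => if Nat.eqb m n then 1 else 0) = nth m env zero.
Proof.
revert m; induction env as [|x env IH]; intros [|m]; cbn; try easy.
- rewrite mlin_zero, plus_zero_r; exact (scal_one x).
- rewrite IH; etransitivity; [|apply plus_zero_l]; f_equal.
  exact (scal_zero_l x).
Qed.

Lemma meval_mlin (env : list V) (e : mexp) : meval env e = mlin env (mcoef e).
Proof.
induction e; cbn [meval].
- symmetry; apply mlin_var.
- symmetry; apply mlin_zero.
- rewrite IHe1, IHe2; symmetry; apply mlin_plus.
- rewrite IHe; symmetry; apply mlin_opp.
- rewrite IHe; symmetry; apply mlin_scal.
Qed.

Lemma meval_eq (env : list V) (e f : mexp) :
  mlin_eq env (mcoef e) (mcoef f) -> meval env e = meval env f.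
Proof. intros H; rewrite !meval_mlin; now apply mlin_ext. Qed.

End ModuleEquations.

Ltac mem_env x env :=
  lazymatch env with
  | nil => constr:(false)
  | cons ?y ?env' =>
      match constr:(Set) with
      | _ => let _ := match constr:(Set) with _ => constr_eq x y end in
             constr:(true)
      | _ => mem_env x env'
      end
  end.

Ltac index_env x env :=
  lazymatch env with
  | cons ?y ?env' =>
      match constr:(Set) with
      | _ => let _ := match constr:(Set) with _ => constr_eq x y end in
             constr:(O)
      | _ => let n := index_env x env' in constr:(S n)
      end
  end.

Ltac collect_env t env :=
  lazymatch t with
  | @plus _ ?a ?b => let env := collect_env a env in collect_env b env
  | @minus _ ?a ?b => let env := collect_env a env in collect_env b env
  | @opp _ ?a => collect_env a env
  | @zero _ => env
  | @scal _ _ _ ?a => collect_env a env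
  | _ => match mem_env t env with
         | true => env
         | false => constr:(cons t env)
         end
  end.

Ltac reify_mexp t env :=
  lazymatch t with
  | @plus _ ?a ?b =>
      let a := reify_mexp a env in let b := reify_mexp b env in
      constr:(MPlus a b)
  | @minus _ ?a ?b =>
      let a := reify_mexp a env in let b := reify_mexp b env in
      constr:(MPlus a (MOpp b))
  | @opp _ ?a => let a := reify_mexp a env in constr:(MOpp a)
  | @zero _ => constr:(MZero)
  | @scal _ _ ?r ?a => let a := reify_mexp a env in constr:(MScal r a)
  | _ => let n := index_env t env in constr:(MVar n)
  end.

(* Decides an equation between linear combinations in a real module by
   comparing the coefficients of each atom. *)
Ltac module_reflect :=
  lazymatch goal with
  | |- @eq ?T ?a ?b =>
      let env := collect_env a (@nil T) in
      let env := collect_env b env in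
      let ea := reify_mexp a env in
      let eb := reify_mexp b env in
      change (meval env ea = meval env eb);
      apply meval_eq;
      cbn [mlin_eq mcoef Nat.eqb]; repeat split;
      unfold one, mult; cbn
  end.

Ltac module_eq := module_reflect; ring.

Ltac module_field := module_reflect; field.

(** * Derivatives relative to a set and the Henstock-Kurzweil integral *)

Ltac norm_tri :=
  lazymatch goal with
  | |- Rle (norm (@plus _ ?x ?y)) _ =>
      apply Rle_trans with (norm x + norm y); [exact (norm_triangle x y)|]
  | |- Rlt (norm (@plus _ ?x ?y)) _ =>
      apply Rle_lt_trans with (norm x + norm y); [exact (norm_triangle x y)|]
  end.

(** A normed module postulates only the inequality [<=]; the reverse one is the same axiom for the
    scalar [/ r]. *)
Lemma norm_scal_Rabs {V : NormedModule R_AbsRing} (r : R) (x : V) : norm (scal r x) = Rabs r * norm x.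
Proof.
apply Rle_antisym; [exact (norm_scal r x)|].
destruct (Req_dec r 0) as [->|Hr].
- rewrite Rabs_R0, Rmult_0_l; apply norm_ge_0.
- replace (norm x) with (norm (scal (/ r) (scal r x)))
    by (f_equal; module_field; exact Hr).
  assert (H := norm_scal (/ r) (scal r x)).
  change (abs (/ r)) with (Rabs (/ r)) in H; rewrite Rabs_inv in H.
  apply Rabs_no_R0 in Hr; assert (Hp := Rabs_pos r).
  apply (Rmult_le_compat_l (Rabs r)) in H; [|easy].
  eapply Rle_trans; [exact H|].
  rewrite <- Rmult_assoc, Rinv_r, Rmult_1_l by easy; apply Rle_refl.
Qed.

(* The same operation reaches a goal through different chains of canonical
   projections, which [rewrite] does not identify; hence these tactics, which
   only ask for convertibility. *)
Ltac norm_scal_eq :=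
  match goal with
  | |- context [@norm ?K ?V (@scal ?A ?B ?r ?x)] =>
      replace (@norm K V (@scal A B r x)) with (Rabs r * @norm K V x)
        by (symmetry; exact (norm_scal_Rabs r x))
  end.

Ltac norm_scal_eq_in H :=
  match type of H with
  | context [@norm ?K ?V (@scal ?A ?B ?r ?x)] =>
      replace (@norm K V (@scal A B r x)) with (Rabs r * @norm K V x) in H
        by (symmetry; exact (norm_scal_Rabs r x))
  end.

Ltac norm_opp_eq :=
  match goal with
  | |- context [@norm ?K ?V (@opp ?A ?x)] =>
      replace (@norm K V (@opp A x)) with (@norm K V x)
        by (symmetry; exact (norm_opp x))
  end.

Ltac norm_zero_eq :=
  match goal with
  | |- context [@norm ?K ?V (@zero ?A)] =>
      replace (@norm K V (@zero A)) with 0 by (symmetry; exact norm_zero)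
  end.

Tactic Notation "norm_as" constr(e) "by" tactic3(tac) :=
  lazymatch goal with
  | |- ?Rel (@norm ?K ?V ?x) ?b =>
      let H := fresh in
      assert (H : x = e); [tac|rewrite H; clear H]
  end.

(** * Limits and relative derivatives in epsilon-delta form *)

Section EpsilonForms.

Context {V : NormedModule R_AbsRing}.

(** Balls of the uniform structure and balls of the norm agree only up to [norm_factor], hence the
    rescaled radius in one direction. *)
Lemma filterlim_within_eps (D : R -> Prop) (f : R -> V) (t : R) (l : V) :
  filterlim f (within D (locally t)) (locally l) <->
  forall eps, 0 < eps -> exists delta, 0 < delta /\
    forall s, D s -> Rabs (s - t) < delta -> norm (minus (f s) l) < eps.
Proof.
split.
- intros H eps Heps.
  pose proof (@norm_factor_gt_0 R_AbsRing V) as Hn.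
  assert (He : 0 < eps / norm_factor (V := V)) by now apply Rdiv_lt_0_compat.
  destruct (proj1 (filterlim_locally f l) H (mkposreal _ He)) as [d Hd].
  exists d; split; [apply cond_pos|]; intros s Ds Hs.
  generalize (norm_compat2 _ _ _ (Hd s Hs Ds)); cbn.
  now replace (norm_factor (V := V) * (eps / norm_factor (V := V))) with eps
    by (field; lra).
- intros H; apply filterlim_locally; intros eps.
  destruct (H eps (cond_pos eps)) as (d & Hd & Hs).
  exists (mkposreal d Hd); intros s Hsd Ds; apply norm_compat1; now apply Hs.
Qed.

Lemma continuous_on_eps (D : R -> Prop) (f : R -> V) :
  continuous_on D f <-> forall t, D t ->
  forall eps, 0 < eps -> exists delta, 0 < delta /\
    forall s, D s -> Rabs (s - t) < delta -> norm (minus (f s) (f t)) < eps.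
Proof.
split; intros H t Dt; [now apply filterlim_within_eps, H|].
now apply filterlim_within_eps, H.
Qed.

Lemma continuous_eps (f : R -> V) (t : R) :
  continuous f t <->
  forall eps, 0 < eps -> exists delta, 0 < delta /\
    forall s, Rabs (s - t) < delta -> norm (minus (f s) (f t)) < eps.
Proof.
assert (E : continuous f t <->
  filterlim f (within (fun _ => True) (locally t)) (locally (f t))).
{ split; intros H P HP; specialize (H P HP); revert H;
    unfold filtermap, within; apply filter_imp; auto. }
rewrite E, filterlim_within_eps.
split; intros H eps Heps; destruct (H eps Heps) as (d & Hd & Hs);
  exists d; auto.
Qed.

Lemma continuous_on_of_continuous (D : R -> Prop) (f : R -> V) :
  (forall t, D t -> continuous f t) -> continuous_on D f.
Proof.
intros H; apply continuous_on_eps; intros t Dt eps Heps.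
destruct (proj1 (continuous_eps f t) (H t Dt) eps Heps) as (d & Hd & Hs).
exists d; auto.
Qed.

Lemma is_derive_within_eps (D : R -> Prop) (f : R -> V) (t : R) (l : V) :
  D t -> (is_derive_within D f t l <->
  forall eps, 0 < eps -> exists delta, 0 < delta /\
    forall s, D s -> Rabs (s - t) < delta ->
      norm (minus (minus (f s) (f t)) (scal (s - t) l)) <= eps * Rabs (s - t)).
Proof.
intros Dt; split.
- intros [_ H] eps Heps.
  assert (Hl : is_filter_lim (within D (locally t)) t).
  { intros P; unfold within; apply filter_imp; auto. }
  destruct (H t Hl (mkposreal eps Heps)) as [d Hd].
  exists d; split; [apply cond_pos|]; intros s Ds Hs; exact (Hd s Hs Ds).
- intros H; split; [exact (@is_linear_scal_l R_AbsRing V l)|].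
  intros x Hx.
  (* As [D t] holds, every member of the filter contains [t]; a limit point [x] other than [t] is
     refuted by its ball of radius [|x - t|]. *)
  assert (x = t) as ->.
  { apply Rminus_diag_uniq, NNPP; intros Hn.
    assert (Hp : 0 < Rabs (x - t)) by now apply Rabs_pos_lt.
    destruct (Hx _ (locally_ball x (mkposreal _ Hp))) as [d Hd].
    generalize (Hd t (ball_center t d) Dt).
    change (Rabs (t - x) < Rabs (x - t) -> False).
    rewrite Rabs_minus_sym; apply Rlt_irrefl. }
  intros eps; destruct (H eps (cond_pos eps)) as (d & Hd & Hs).
  exists (mkposreal d Hd); intros s Hsd Ds; now apply Hs.
Qed.

Lemma is_derive_eps (f : R -> V) (t : R) (l : V) :
  is_derive f t l <->
  forall eps, 0 < eps -> exists delta, 0 < delta /\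
    forall s, Rabs (s - t) < delta ->
      norm (minus (minus (f s) (f t)) (scal (s - t) l)) <= eps * Rabs (s - t).
Proof.
assert (E : is_derive f t l <-> is_derive_within (fun _ => True) f t l).
{ split; intros [Hl H]; split; trivial; intros x Hx eps.
  - assert (Hx' : is_filter_lim (locally t) x).
    { intros P HP; specialize (Hx P HP); revert Hx.
      unfold within; apply filter_imp; auto. }
    generalize (H x Hx' eps); unfold within; apply filter_imp; auto.
  - assert (Hx' : is_filter_lim (within (fun _ => True) (locally t)) x).
    { intros P HP; generalize (Hx P HP); unfold within; apply filter_imp; auto. }
    generalize (H x Hx' eps); unfold within; apply filter_imp; auto. }
rewrite E, (is_derive_within_eps _ _ _ _ I).
split; intros H eps Heps; destruct (H eps Heps) as (d & Hd & Hs);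
  exists d; auto.
Qed.

Lemma is_derive_within_of_is_derive (D : R -> Prop) (f : R -> V) (t : R)
    (l : V) : D t -> is_derive f t l -> is_derive_within D f t l.
Proof.
intros Dt H; apply is_derive_within_eps; trivial; intros eps Heps.
destruct (proj1 (is_derive_eps f t l) H eps Heps) as (d & Hd & Hs).
exists d; auto.
Qed.

Lemma is_derive_within_loc (D D' : R -> Prop) (f g : R -> V) (t : R) (l : V) :
  D t -> D' t -> f t = g t ->
  (exists delta, 0 < delta /\
    forall s, D' s -> Rabs (s - t) < delta -> D s /\ f s = g s) ->
  is_derive_within D f t l -> is_derive_within D' g t l.
Proof.
intros Dt D't Et (d0 & Hd0 & H0) H.
apply is_derive_within_eps; trivial; intros eps Heps.
destruct (proj1 (is_derive_within_eps D f t l Dt) H eps Heps) as (d & Hd & Hs).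
exists (Rmin d d0); split; [now apply Rmin_pos|]; intros s Ds Hds.
pose proof (Rmin_l d d0); pose proof (Rmin_r d d0).
destruct (H0 s Ds ltac:(lra)) as [Ds' Es].
rewrite <- Es, <- Et; apply Hs; trivial; lra.
Qed.

Lemma continuous_on_loc (D D' : R -> Prop) (f g : R -> V) (t : R) :
  f t = g t ->
  (exists delta, 0 < delta /\
    forall s, D' s -> Rabs (s - t) < delta -> D s /\ f s = g s) ->
  filterlim f (within D (locally t)) (locally (f t)) ->
  filterlim g (within D' (locally t)) (locally (g t)).
Proof.
intros Et (d0 & Hd0 & H0) H.
apply filterlim_within_eps; intros eps Heps.
destruct (proj1 (filterlim_within_eps D f t (f t)) H eps Heps)
  as (d & Hd & Hs).
exists (Rmin d d0); split; [now apply Rmin_pos|]; intros s Ds Hds.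
pose proof (Rmin_l d d0); pose proof (Rmin_r d d0).
destruct (H0 s Ds ltac:(lra)) as [Ds' Es].
rewrite <- Es, <- Et; apply Hs; trivial; lra.
Qed.

Lemma is_derive_within_continuous (D : R -> Prop) (f : R -> V) (t : R) (l : V) :
  D t -> is_derive_within D f t l ->
  filterlim f (within D (locally t)) (locally (f t)).
Proof.
intros Dt H; apply filterlim_within_eps; intros eps Heps.
destruct (proj1 (is_derive_within_eps D f t l Dt) H 1 Rlt_0_1) as (d & Hd & Hs).
assert (Hn := norm_ge_0 l).
assert (Hp : 0 < eps / (2 + norm l)) by (apply Rdiv_lt_0_compat; lra).
exists (Rmin d (eps / (2 + norm l))); split; [now apply Rmin_pos|].
intros s Ds Hds.
pose proof (Rmin_l d (eps / (2 + norm l))).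
pose proof (Rmin_r d (eps / (2 + norm l))).
specialize (Hs s Ds ltac:(lra)).
replace (minus (f s) (f t)) with
  (plus (minus (minus (f s) (f t)) (scal (s - t) l)) (scal (s - t) l))
  by module_eq.
norm_tri.
assert (Hl := Req_le _ _ (norm_scal_Rabs (s - t) l)).
assert (Rabs (s - t) * (2 + norm l) < eps).
{ apply (Rlt_le_trans _ (eps / (2 + norm l) * (2 + norm l)));
    [apply Rmult_lt_compat_r; lra|].
  right; field; lra. }
eapply Rle_lt_trans; [apply Rplus_le_compat; [exact Hs|exact Hl]|].
assert (Hr := Rabs_pos (s - t)); lra.
Qed.

Lemma C1_on_continuous_on (D : R -> Prop) (f df : R -> V) :
  C1_on D f df -> continuous_on D f.
Proof.
intros [H _] t Dt; exact (is_derive_within_continuous _ _ _ _ Dt (H t Dt)).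
Qed.

Lemma is_derive_within_glue (D : R -> Prop) (c : R) (f : R -> V) (t : R) (l : V) :
  D t ->
  (t <= c -> is_derive_within (fun s => D s /\ s <= c) f t l) ->
  (c <= t -> is_derive_within (fun s => D s /\ c <= s) f t l) ->
  is_derive_within D f t l.
Proof.
intros Dt H1 H2; destruct (total_order_T t c) as [[Hlt| ->]|Hgt].
- apply (is_derive_within_loc (fun s => D s /\ s <= c) D f f); trivial;
    [split; trivial; lra| |apply H1; lra].
  exists (c - t); split; [lra|]; intros s Ds Hs; apply Rabs_def2 in Hs.
  repeat split; trivial; lra.
- apply is_derive_within_eps; trivial; intros eps Heps.
  specialize (H1 ltac:(lra)); specialize (H2 ltac:(lra)).
  destruct (proj1 (is_derive_within_eps (fun s => D s /\ s <= c) f c l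
    (conj Dt (Rle_refl c))) H1 eps Heps) as (d1 & Hd1 & Hs1).
  destruct (proj1 (is_derive_within_eps (fun s => D s /\ c <= s) f c l
    (conj Dt (Rle_refl c))) H2 eps Heps) as (d2 & Hd2 & Hs2).
  exists (Rmin d1 d2); split; [now apply Rmin_pos|]; intros s Ds Hs.
  pose proof (Rmin_l d1 d2); pose proof (Rmin_r d1 d2).
  destruct (Rle_dec s c); [apply Hs1|apply Hs2]; try split; trivial; lra.
- apply (is_derive_within_loc (fun s => D s /\ c <= s) D f f); trivial;
    [split; trivial; lra| |apply H2; lra].
  exists (t - c); split; [lra|]; intros s Ds Hs; apply Rabs_def2 in Hs.
  repeat split; trivial; lra.
Qed.

Lemma continuous_on_glue (D : R -> Prop) (c : R) (f : R -> V) :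
  continuous_on (fun s => D s /\ s <= c) f ->
  continuous_on (fun s => D s /\ c <= s) f -> continuous_on D f.
Proof.
intros H1 H2 t Dt; destruct (total_order_T t c) as [[Hlt| ->]|Hgt].
- apply (continuous_on_loc (fun s => D s /\ s <= c) D f f); trivial;
    [|apply H1; split; trivial; lra].
  exists (c - t); split; [lra|]; intros s Ds Hs; apply Rabs_def2 in Hs.
  repeat split; trivial; lra.
- specialize (H1 c ltac:(split; [easy|lra])).
  specialize (H2 c ltac:(split; [easy|lra])).
  apply filterlim_within_eps; intros eps Heps.
  destruct (proj1 (filterlim_within_eps _ _ _ _) H1 eps Heps)
    as (d1 & Hd1 & Hs1).
  destruct (proj1 (filterlim_within_eps _ _ _ _) H2 eps Heps)
    as (d2 & Hd2 & Hs2).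
  exists (Rmin d1 d2); split; [now apply Rmin_pos|]; intros s Ds Hs.
  pose proof (Rmin_l d1 d2); pose proof (Rmin_r d1 d2).
  destruct (Rle_dec s c); [apply Hs1|apply Hs2]; try split; trivial; lra.
- apply (continuous_on_loc (fun s => D s /\ c <= s) D f f); trivial;
    [|apply H2; split; trivial; lra].
  exists (t - c); split; [lra|]; intros s Ds Hs; apply Rabs_def2 in Hs.
  repeat split; trivial; lra.
Qed.

Lemma C1_on_glue (D : R -> Prop) (c : R) (f df : R -> V) :
  C1_on (fun s => D s /\ s <= c) f df ->
  C1_on (fun s => D s /\ c <= s) f df -> C1_on D f df.
Proof.
intros [H1 C1] [H2 C2]; split.
- intros t Dt; apply (is_derive_within_glue D c); auto.
- now apply (continuous_on_glue D c).
Qed.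

Lemma C1_on_ext (D D' : R -> Prop) (f df g dg : R -> V) :
  (forall t, D' t -> D t /\ f t = g t /\ df t = dg t) ->
  C1_on D f df -> C1_on D' g dg.
Proof.
intros E [H C]; split.
- intros t Dt; destruct (E t Dt) as (Dt' & Ef & Edf).
  rewrite <- Edf.
  apply (is_derive_within_loc D D' f g); auto.
  exists 1; split; [lra|]; intros s Ds _; now destruct (E s Ds) as (? & ? & ?).
- intros t Dt; destruct (E t Dt) as (Dt' & Ef & Edf).
  apply (continuous_on_loc D D' df dg); auto.
  exists 1; split; [lra|]; intros s Ds _; now destruct (E s Ds) as (? & ? & ?).
Qed.

(** The two remainders at a point [s <> t] of [D] differ by [(s - t)(l - l')], which is thus at most
    [eps |s - t|]; accumulation of [D] at [t] provides such points. *)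
Lemma is_derive_within_unique (D : R -> Prop) (f : R -> V) (t : R) (l l' : V) :
  D t ->
  (forall delta, 0 < delta -> exists s, D s /\ s <> t /\ Rabs (s - t) < delta) ->
  is_derive_within D f t l -> is_derive_within D f t l' -> l = l'.
Proof.
intros Dt Hacc H H'.
assert (Hz : norm (minus l l') = 0).
{ apply Rle_antisym; [|apply norm_ge_0]; apply le_epsilon; intros eps Heps.
  destruct (proj1 (is_derive_within_eps D f t l Dt) H (eps / 2) ltac:(lra))
    as (d & Hd & Hs).
  destruct (proj1 (is_derive_within_eps D f t l' Dt) H' (eps / 2) ltac:(lra))
    as (d' & Hd' & Hs').
  destruct (Hacc (Rmin d d') ltac:(now apply Rmin_pos)) as (s & Ds & Hst & Hsd).
  pose proof (Rmin_l d d'); pose proof (Rmin_r d d').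
  specialize (Hs s Ds ltac:(lra)); specialize (Hs' s Ds ltac:(lra)).
  assert (Hp : 0 < Rabs (s - t)) by (apply Rabs_pos_lt; lra).
  assert (Hn : norm (scal (s - t) (minus l l')) <= eps * Rabs (s - t)).
  { replace (scal (s - t) (minus l l')) with
      (plus (minus (minus (f s) (f t)) (scal (s - t) l'))
         (opp (minus (minus (f s) (f t)) (scal (s - t) l)))) by module_eq.
    norm_tri; rewrite norm_opp; lra. }
  norm_scal_eq_in Hn.
  nra. }
apply norm_eq_zero in Hz.
transitivity (plus (minus l l') l'); [module_eq|rewrite Hz; module_eq].
Qed.

End EpsilonForms.

(** * Fundamental theorem of calculus for the Henstock-Kurzweil integral *)

Fixpoint step_sum (E : list R) (x : R) : R :=
  match E with
  | nil => 0
  | cons e E' => sign (x - e) + step_sum E' x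
  end.

Lemma step_sum_le (E : list R) (x y : R) :
  x <= y -> step_sum E x <= step_sum E y.
Proof.
intros H; induction E as [|e E IH]; cbn; [lra|].
assert (sign (x - e) <= sign (y - e)) by (apply sign_le; lra); lra.
Qed.

(** [sign] rises by 1 on each side of its zero, so even an interval that has [e] as an endpoint
    gains a full unit. *)
Lemma step_sum_jump (E : list R) (e x y : R) :
  In e E -> x <= e <= y -> x < y -> step_sum E x + 1 <= step_sum E y.
Proof.
intros He Hxy Hlt; induction E as [|e' E IH]; [easy|]; cbn.
destruct He as [-> |He].
- assert (step_sum E x <= step_sum E y) by (apply step_sum_le; lra).
  destruct (Rle_lt_or_eq_dec x e) as [H1| ->]; [lra| |].
  + rewrite (sign_eq_m1 (x - e)) by lra.
    assert (0 <= sign (y - e)) by (apply sign_ge_0; lra); lra.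
  + rewrite (sign_eq_1 (y - e)) by lra.
    assert (sign (e - e) <= 0) by (apply sign_le_0; lra); lra.
- specialize (IH He).
  assert (sign (x - e') <= sign (y - e')) by (apply sign_le; lra); lra.
Qed.

Section FundamentalTheorem.

Context {V : NormedModule R_AbsRing}.

(* On a subinterval with tag [xi] the error of the Riemann sum is bounded by
   the increment of an increasing control function: the identity deals with
   the differentiability points, a unit jump with each exceptional point. *)
Lemma exists_control_gauge (F f : R -> V) (a b eps : R) (E : list R) :
  0 < eps ->
  continuous_on (fun s => a <= s <= b) F ->
  (forall s, a <= s <= b -> ~ In s E ->
     is_derive_within (fun s => a <= s <= b) F s (f s)) ->
  exists delta : R -> posreal, forall xi u v,
    a <= u <= xi -> xi <= v <= b -> xi - delta xi < u -> v < xi + delta xi ->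
    norm (minus (scal (v - u) (f xi)) (minus (F v) (F u))) <=
    eps * ((v + step_sum E v) - (u + step_sum E u)).
Proof.
intros Heps HF Hd.
apply (functional_choice (fun xi (d : posreal) => forall u v,
  a <= u <= xi -> xi <= v <= b -> xi - d < u -> v < xi + d -> _)).
intros xi; destruct (classic (a <= xi <= b)) as [Hxi|Hxi];
  [|exists (mkposreal 1 Rlt_0_1); intros; lra].
destruct (classic (In xi E)) as [HE|HE].
- destruct (proj1 (continuous_on_eps _ _) HF xi Hxi (eps / 4) ltac:(lra))
    as (d & Hd0 & Hs).
  assert (Hn := norm_ge_0 (f xi)).
  (* At an exceptional tag [f xi] is arbitrary. This radius keeps [(v - u) f xi] below [eps / 2],
     and continuity bounds the two increments of [F] by [eps / 4] each; the unit jump pays for the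
     sum. *)
  assert (Hp : 0 < eps / (4 * (1 + norm (f xi))))
    by (apply Rdiv_lt_0_compat; lra).
  exists (mkposreal _ (Rmin_pos _ _ Hd0 Hp)); cbn.
  pose proof (Rmin_l d (eps / (4 * (1 + norm (f xi))))) as Hl.
  pose proof (Rmin_r d (eps / (4 * (1 + norm (f xi))))) as Hr.
  set (m := Rmin _ _) in *; intros u v Hu Hv Hu' Hv'.
  destruct (Rle_lt_or_eq_dec u v) as [Huv| ->]; [lra| |].
  + assert (Hst := step_sum_jump E xi u v HE ltac:(lra) Huv).
    assert (norm (scal (v - u) (f xi)) <= eps / 2).
    { norm_scal_eq.
      rewrite Rabs_pos_eq by lra.
      assert (m * (1 + norm (f xi)) <= eps / 4).
      { apply (Rmult_le_reg_r (/ (1 + norm (f xi))));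
          [apply Rinv_0_lt_compat; lra|].
        rewrite Rmult_assoc, Rinv_r, Rmult_1_r by lra.
        replace (eps / 4 * / (1 + norm (f xi)))
          with (eps / (4 * (1 + norm (f xi)))) by (field; lra); lra. }
      nra. }
    assert (H1 := Hs u ltac:(lra) ltac:(apply Rabs_def1; lra)).
    assert (H2 := Hs v ltac:(lra) ltac:(apply Rabs_def1; lra)).
    replace (minus (scal (v - u) (f xi)) (minus (F v) (F u))) with
      (plus (scal (v - u) (f xi))
        (plus (minus (F u) (F xi)) (opp (minus (F v) (F xi))))) by module_eq.
    norm_tri.
    apply Rle_trans with (norm (scal (v - u) (f xi)) + (norm (minus (F u) (F xi)) + norm (opp (minus (F v) (F xi)))));
      [apply Rplus_le_compat_l, norm_triangle|].
    rewrite norm_opp; nra.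
  + replace (minus (scal (v - v) (f xi)) (minus (F v) (F v))) with (@zero V)
      by module_eq.
    rewrite norm_zero; lra.
- destruct (proj1 (is_derive_within_eps (fun s => a <= s <= b) F xi (f xi) Hxi)
    (Hd xi Hxi HE) eps Heps) as (d & Hd0 & Hs).
  exists (mkposreal d Hd0); cbn; intros u v Hu Hv Hu' Hv'.
  assert (H1 := Hs u ltac:(lra) ltac:(apply Rabs_def1; lra)).
  assert (H2 := Hs v ltac:(lra) ltac:(apply Rabs_def1; lra)).
  rewrite Rabs_minus_sym, Rabs_pos_eq in H1 by lra.
  rewrite Rabs_pos_eq in H2 by lra.
  assert (Hst := step_sum_le E u v ltac:(lra)).
  (* Straddle estimate: both endpoints are compared with the tag, and [eps (xi - u) + eps (v - xi)]
     is exactly [eps (v - u)]. *)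
  replace (minus (scal (v - u) (f xi)) (minus (F v) (F u))) with
    (plus (minus (minus (F u) (F xi)) (scal (u - xi) (f xi)))
      (opp (minus (minus (F v) (F xi)) (scal (v - xi) (f xi)))))
    by module_eq.
  norm_tri; rewrite norm_opp; nra.
Qed.

(** The gauge may shrink around each tag as the differentiability there dictates, so [f] itself
    needs no uniformity. The local errors are increments of [H x = x + step_sum E x] and
    telescope. *)
Lemma is_HKInt_derive (F f : R -> V) (a b : R) (E : list R) :
  a < b ->
  continuous_on (fun s => a <= s <= b) F ->
  (forall s, a <= s <= b -> ~ In s E ->
     is_derive_within (fun s => a <= s <= b) F s (f s)) ->
  is_HKInt f a b (minus (F b) (F a)).
Proof.
intros Hab HF Hd.
apply (filterlim_locally (F := HK_fine a b)); intros eps.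
set (H := fun x => x + step_sum E x).
assert (HH : 0 < H b - H a).
{ unfold H; assert (Hst := step_sum_le E a b ltac:(lra)); lra. }
(* The telescoped error is [e (H b - H a) = eps / 2], strictly below [eps]. *)
set (e := eps / (2 * (H b - H a))).
assert (He : 0 < e) by (apply Rdiv_lt_0_compat; [apply cond_pos|lra]).
destruct (exists_control_gauge F f a b e E He HF Hd) as [delta Hdelta].
exists delta; intros [h t] Hp Hg Hh Hl.
rewrite Rmin_left in Hh by lra; rewrite Rmax_right in Hl by lra.
apply norm_compat1.
rewrite sign_eq_1 by lra.
replace (scal 1 (Riemann_sum f (mkSF_seq h t)))
  with (Riemann_sum f (mkSF_seq h t)) by module_eq.
(* The induction keeps the right end [b] and moves the left end [h]; the conjunct [h <= b] keeps
   each cell inside [[a, b]], as the gauge estimate requires. *)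
cut (h <= b /\ norm (minus (Riemann_sum f (mkSF_seq h t))
    (minus (F b) (F h))) <= e * (H b - H h)).
{ cbn in Hh; subst h; intros [_ Hle]; eapply Rle_lt_trans; [exact Hle|].
  unfold e; replace (eps / (2 * (H b - H a)) * (H b - H a)) with (eps / 2)
    by (field; lra).
  assert (Hpos := cond_pos eps); lra. }
cbn in Hh; assert (Hah : a <= h) by lra; clear Hh.
revert h Hah Hp Hg Hl; induction t as [|[h' y] t IH]; intros h Hah Hp Hg Hl.
- cbn in Hl; subst h; split; [lra|].
  replace (minus (Riemann_sum f (mkSF_seq b nil)) (minus (F b) (F b)))
    with (@zero V) by (unfold Riemann_sum; cbn; module_eq).
  rewrite norm_zero; lra.
- assert (Hp0 := Hp 0%nat ltac:(cbn; lia)); cbn in Hp0.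
  assert (Hg0 := Hg 0%nat ltac:(cbn; lia)); cbn in Hg0.
  destruct (IH h') as [Hb Hn]; trivial.
  + lra.
  + intros i Hi; apply (Hp (S i)); cbn in *; lia.
  + intros i Hi; apply (Hg (S i)); cbn in *; lia.
  + split; [lra|].
    change (mkSF_seq h (cons (h', y) t)) with (SF_cons (h, y) (mkSF_seq h' t)).
    rewrite Riemann_sum_cons; cbn [SF_h fst snd].
    assert (Hs := Hdelta y h h' ltac:(lra) ltac:(lra) ltac:(lra) ltac:(lra)).
    replace (minus (plus (scal (h' - h) (f y)) (Riemann_sum f (mkSF_seq h' t)))
      (minus (F b) (F h))) with
      (plus (minus (scal (h' - h) (f y)) (minus (F h') (F h)))
        (minus (Riemann_sum f (mkSF_seq h' t)) (minus (F b) (F h'))))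
      by module_eq.
    norm_tri.
    fold (H h) in Hs; fold (H h') in Hs; unfold H in *; lra.
Qed.

(** Tags stay in the interval, so the Riemann sum of [f - g] is bounded by that of the zero
    function. *)
Lemma is_HKInt_ext (f g : R -> V) (a b : R) (I : V) :
  (forall s, Rmin a b <= s <= Rmax a b -> f s = g s) ->
  is_HKInt f a b I -> is_HKInt g a b I.
Proof.
intros E; apply filterlim_ext_loc.
exists (fun _ => mkposreal 1 Rlt_0_1); intros ptd Hp _ Hh Hl.
apply (f_equal (scal (sign (b - a)))).
assert (Hn := Riemann_sum_norm (fun s => minus (f s) (g s)) (fun _ => 0) ptd Hp).
rewrite Hl, Hh in Hn.
assert (Hz : forall s, Rmin a b <= s <= Rmax a b ->
  norm (minus (f s) (g s)) <= 0).
{ intros s Hs; rewrite E by trivial; norm_as (@zero V) by module_eq.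
  norm_zero_eq; apply Rle_refl. }
specialize (Hn Hz).
assert (E0 : Riemann_sum (fun s => minus (f s) (g s)) ptd = (zero : V)).
{ apply (@norm_eq_zero R_AbsRing V), Rle_antisym; [|apply norm_ge_0].
  eapply Rle_trans; [exact Hn|]; right.
  etransitivity; [exact (Riemann_sum_const 0 ptd)|apply Rmult_0_r]. }
assert (E1 := eq_trans (eq_sym E0) (Riemann_sum_minus f g ptd)).
transitivity (plus (minus (Riemann_sum f ptd) (Riemann_sum g ptd))
  (Riemann_sum g ptd)); [module_eq|].
exact (eq_trans (f_equal (fun z => plus z (Riemann_sum g ptd)) (eq_sym E1))
  (plus_zero_l _)).
Qed.

Lemma is_HKInt_plus (f g : R -> V) (a b : R) (I J : V) :
  is_HKInt f a b I -> is_HKInt g a b J ->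
  is_HKInt (fun s => plus (f s) (g s)) a b (plus I J).
Proof.
intros HI HJ.
assert (FF := HK_fine_filter a b).
refine (filterlim_ext _ _ _ (filterlim_comp_2 _ _ _ HI HJ (filterlim_plus I J))).
intros ptd; cbn beta.
etransitivity; [symmetry; exact (scal_distr_l (sign (b - a)) _ _)|].
apply (f_equal (scal (sign (b - a)))); symmetry.
exact (Riemann_sum_plus f g ptd).
Qed.

(** A Riemann integral is also a Henstock-Kurzweil integral, and uniqueness of the latter identifies
    its value. *)
Lemma is_RInt_derive_within (F f : R -> V) (a b : R) (E : list R) :
  a <= b ->
  continuous_on (fun s => a <= s <= b) F ->
  (forall s, a <= s <= b -> ~ In s E ->
     is_derive_within (fun s => a <= s <= b) F s (f s)) ->
  ex_RInt f a b -> is_RInt f a b (minus (F b) (F a)).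
Proof.
intros Hab HF Hd [I HI].
destruct (Rle_lt_or_eq_dec a b Hab) as [Hlt| <-].
- replace (minus (F b) (F a)) with I; trivial.
  apply (is_HKInt_unique f a b); [now apply is_HKInt_RInt|].
  now apply (is_HKInt_derive F f a b E).
- replace (minus (F a) (F a)) with (@zero V) by module_eq.
  apply is_RInt_point.
Qed.

End FundamentalTheorem.

(** * Uniform boundedness and linear maps *)

Section UniformBoundedness.

Context {Y : CompleteNormedModule R_AbsRing}.

(** A step of the gliding hump argument. If [L n] is large on a vector [cz] of norm [r / 2], it is
    large at [x + cz] or at [x - cz], because these two values differ by [2 L n (cz)]. *)
Lemma unbounded_on_small_ball (L : nat -> Y -> Y) (x : Y) (r K : R) :
  (forall n, is_linear (L n)) ->
  (~ exists M, 0 < M /\ forall n y, norm (L n y) <= M * norm y) ->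
  0 < r -> 0 <= K ->
  exists (x' : Y) (r' : R), 0 < r' <= r / 2 /\ norm (minus x' x) <= r / 2 /\
    exists n, forall y, norm (minus y x') <= r' -> K <= norm (L n y).
Proof.
intros HL Hunb Hr HK.
(* Chosen so that a [z] with [|L n z| > M |z|], rescaled to norm [r / 2], satisfies
   [|L n (cz)| >= K + 1]. *)
set (M := 2 * (K + 1) / r).
assert (HM : 0 < M) by (apply Rdiv_lt_0_compat; lra).
destruct (classic (exists n y, M * norm y < norm (L n y))) as [(n & z & Hz)|Hn];
  [|exfalso; apply Hunb; exists M; split; trivial; intros n y;
    apply Rnot_lt_le; intros Hlt; apply Hn; now exists n, y].
destruct (linear_norm _ (HL n)) as (C & HC & HCb).
assert (Hz0 : 0 < norm z).
{ apply Rnot_le_lt; intros Hle; specialize (HCb z).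
  assert (Hz1 := norm_ge_0 z); assert (norm z = 0) as E by lra.
  rewrite E in *; lra. }
set (c := r / 2 / norm z).
assert (Hc : 0 < c) by (apply Rdiv_lt_0_compat; lra).
assert (Hcz : norm (scal c z) = r / 2).
{ norm_scal_eq; rewrite Rabs_pos_eq by lra; unfold c; field; lra. }
assert (HLz : K + 1 <= norm (L n (scal c z))).
{ replace (L n (scal c z)) with (scal c (L n z))
    by (symmetry; exact (linear_scal _ (HL n) c z)).
  norm_scal_eq; rewrite Rabs_pos_eq by lra.
  apply Rle_trans with (c * (M * norm z));
    [|apply Rmult_le_compat_l; lra].
  right; unfold c, M; field; lra. }
assert (Hx' : exists x', norm (minus x' x) <= r / 2 /\ K + 1 <= norm (L n x')).
{ destruct (Rle_dec (K + 1) (norm (L n (plus x (scal c z))))) as [H1|H1].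
  - exists (plus x (scal c z)); split; trivial.
    replace (minus (plus x (scal c z)) x) with (scal c z) by module_eq; lra.
  - exists (plus x (scal (-1) (scal c z))); split.
    + replace (minus (plus x (scal (-1) (scal c z))) x)
        with (opp (scal c z)) by module_eq.
      norm_opp_eq; lra.
    + rewrite (linear_plus _ (HL n)) in H1 |- *.
      replace (L n (scal (-1) (scal c z))) with (scal (-1) (L n (scal c z)))
        by (symmetry; exact (linear_scal _ (HL n) (-1) (scal c z))).
      set (p := L n x) in *; set (q := L n (scal c z)) in *.
      change (~ K + 1 <= norm (plus p q)) in H1.
      change (K + 1 <= norm (plus p (scal (-1) q))).
      assert (Ht : norm (scal 2 q) <=
        norm (plus p q) + norm (plus p (scal (-1) q))).
      { replace (scal 2 q) with (plus (plus p q) (opp (plus p (scal (-1) q))))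
          by module_eq.
        norm_tri; norm_opp_eq; apply Rle_refl. }
      norm_scal_eq_in Ht; rewrite Rabs_pos_eq in Ht by lra; lra. }
destruct Hx' as (x' & Hx1 & Hx2).
assert (HCi := Rinv_0_lt_compat _ HC).
(* Within distance [1 / C] of [x'] the value of [L n] moves by at most 1, which is the slack between
   [K + 1] and [K]. *)
exists x', (Rmin (r / 2) (/ C)); repeat split; trivial.
- apply Rmin_pos; lra.
- apply Rmin_l.
- exists n; intros y Hy; assert (Hr' := Rmin_r (r / 2) (/ C)).
  assert (Hd : norm (L n (minus x' y)) <= 1).
  { eapply Rle_trans; [apply HCb|].
    replace (minus x' y) with (opp (minus y x')) by module_eq.
    norm_opp_eq; apply Rle_trans with (C * / C);
      [apply Rmult_le_compat_l; lra|right; field; lra]. }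
  replace x' with (plus (minus x' y) y) in Hx2 by module_eq.
  rewrite (linear_plus _ (HL n)) in Hx2.
  assert (Ht := norm_triangle (L n (minus x' y)) (L n y)); lra.
Qed.

(** Since [r k / 2 <= r k - r (k + 1)], distances telescope to [r k - r (k + m)]; the limit
    therefore lies in all the nested closed balls. *)
Lemma cauchy_sequence_converges (x : nat -> Y) (r : nat -> R) :
  (forall k, 0 < r (S k) <= r k / 2) ->
  (forall k, norm (minus (x (S k)) (x k)) <= r k / 2) ->
  exists l : Y, forall k, norm (minus l (x k)) <= r k.
Proof.
intros Hr Hx.
assert (Hr0 : forall k, 0 < r k) by (intros k; specialize (Hr k); lra).
assert (Hd : forall k m, norm (minus (x (k + m)%nat) (x k)) <= r k - r (k + m)%nat).
{ intros k m; induction m as [|m IH].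
  - rewrite Nat.add_0_r.
    replace (minus (x k) (x k)) with (@zero Y) by module_eq.
    norm_zero_eq; lra.
  - rewrite Nat.add_succ_r; specialize (Hr (k + m)%nat); specialize (Hx (k + m)%nat).
    replace (minus (x (S (k + m))) (x k)) with
      (plus (minus (x (S (k + m))) (x (k + m)%nat)) (minus (x (k + m)%nat) (x k)))
      by module_eq.
    norm_tri; lra. }
assert (Hdecr : forall k, r k <= r 0%nat * (/ 2) ^ k).
{ induction k; cbn; [lra|]; specialize (Hr k); lra. }
assert (Hsmall : forall eps, 0 < eps -> exists k, r k < eps).
{ intros eps Heps; specialize (Hr0 0%nat).
  destruct (pow_lt_1_zero (/ 2) ltac:(rewrite Rabs_pos_eq; lra) (eps / r 0%nat))
    as [N HN]; [now apply Rdiv_lt_0_compat|].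
  exists N; specialize (HN N (le_n N)); eapply Rle_lt_trans; [apply Hdecr|].
  rewrite Rabs_pos_eq in HN by (apply pow_le; lra).
  apply (Rmult_lt_compat_l (r 0%nat)) in HN; trivial.
  eapply Rlt_le_trans; [exact HN|]; right; field; lra. }
assert (Hc : exists l : Y, filterlim x eventually (locally l)).
{ apply (proj1 (filterlim_locally_cauchy (F := eventually) x)); intros eps.
  destruct (Hsmall (eps / 2)) as [k Hk];
    [apply Rdiv_lt_0_compat; [apply cond_pos|lra]|].
  exists (fun m => (k <= m)%nat); split; [now exists k|].
  intros u v Hu Hv; apply (@norm_compat1 R_AbsRing).
  change (norm (minus (x v) (x u)) < eps).
  replace (minus (x v) (x u)) with
    (plus (minus (x v) (x k)) (opp (minus (x u) (x k)))) by module_eq.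
  norm_tri; norm_opp_eq.
  assert (H1 := Hd k (v - k)%nat); assert (H2 := Hd k (u - k)%nat).
  replace (k + (v - k))%nat with v in H1 by lia.
  replace (k + (u - k))%nat with u in H2 by lia.
  assert (H3 := Hr0 u); assert (H4 := Hr0 v); lra. }
destruct Hc as [l Hl]; exists l; intros k; apply le_epsilon; intros eps Heps.
assert (Hn := @norm_factor_gt_0 R_AbsRing Y).
assert (He : 0 < eps / norm_factor (V := Y)) by now apply Rdiv_lt_0_compat.
destruct (proj1 (filterlim_locally x l) Hl (mkposreal _ He)) as [N HN].
specialize (HN (k + N)%nat ltac:(lia)).
apply (@norm_compat2 R_AbsRing) in HN.
change (norm (minus (x (k + N)%nat) l) < norm_factor (V := Y) *
  (eps / norm_factor (V := Y))) in HN.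
replace (norm_factor (V := Y) * (eps / norm_factor (V := Y))) with eps in HN
  by (field; lra).
replace (minus l (x k)) with
  (plus (minus (x (k + N)%nat) (x k)) (opp (minus (x (k + N)%nat) l)))
  by module_eq.
norm_tri; norm_opp_eq.
specialize (Hd k N); specialize (Hr0 (k + N)%nat); lra.
Qed.

(** Otherwise nested balls are chosen so that on the ball built at stage [k] some [L n] is at least
    [k] in norm; their common point contradicts pointwise boundedness. *)
Lemma uniform_boundedness (L : nat -> Y -> Y) :
  (forall n, is_linear (L n)) ->
  (forall x, exists M, forall n, norm (L n x) <= M) ->
  exists M, 0 < M /\ forall n x, norm (L n x) <= M * norm x.
Proof.
intros HL Hb; apply NNPP; intros Hunb.
destruct (functional_choice (fun (kb : nat * (Y * posreal)) (b : Y * posreal) =>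
  let '(k, (x, r)) := kb in
  snd b <= r / 2 /\ norm (minus (fst b) x) <= r / 2 /\
  exists n, forall y, norm (minus y (fst b)) <= snd b -> INR k <= norm (L n y)))
  as [next Hnext].
{ intros [k [x r]].
  destruct (unbounded_on_small_ball L x r (INR k) HL Hunb (cond_pos r)
    (pos_INR k)) as (x' & r' & [Hr' Hr2] & H).
  now exists (x', mkposreal r' Hr'). }
set (b := fix b (k : nat) : Y * posreal :=
  match k with
  | O => (zero, mkposreal 1 Rlt_0_1)
  | S k => next (k, b k)
  end).
assert (Hb' : forall k, snd (b (S k)) <= snd (b k) / 2 /\
  norm (minus (fst (b (S k))) (fst (b k))) <= snd (b k) / 2 /\
  exists n, forall y, norm (minus y (fst (b (S k)))) <= snd (b (S k)) ->
    INR k <= norm (L n y)).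
{ intros k; specialize (Hnext (k, b k)); cbn in *.
  destruct (b k) as [x r]; exact Hnext. }
destruct (cauchy_sequence_converges (fun k => fst (b k))
  (fun k => pos (snd (b k)))) as [l Hl].
- intros k; split; [apply cond_pos|apply Hb'].
- intros k; apply Hb'.
- destruct (Hb l) as [M HM].
  assert (HM0 := Rle_trans _ _ _ (norm_ge_0 _) (HM 0%nat)).
  destruct (INR_unbounded M) as [k Hk].
  destruct (Hb' k) as (_ & _ & n & Hn).
  specialize (Hn l (Hl (S k))); specialize (HM n); lra.
Qed.

End UniformBoundedness.

Section LinearMaps.

Context {V : CompleteNormedModule R_AbsRing}.

Lemma linear_scal_real (L : V -> V) (r : R) (x : V) :
  is_linear L -> L (scal r x) = scal r (L x).
Proof. intros HL; exact (linear_scal _ HL r x). Qed.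

Lemma linear_minus (L : V -> V) (x y : V) :
  is_linear L -> L (minus x y) = minus (L x) (L y).
Proof.
intros HL; replace (minus x y) with (plus x (scal (-1) y)) by module_eq.
rewrite (linear_plus _ HL).
replace (L (scal (-1) y)) with (scal (-1) (L y))
  by (symmetry; exact (linear_scal _ HL (-1) y)); module_eq.
Qed.

Lemma linear_zero (L : V -> V) : is_linear L -> L zero = zero.
Proof.
intros HL; transitivity (L (minus zero zero)); [f_equal; module_eq|].
rewrite (linear_minus L) by trivial; module_eq.
Qed.

Lemma is_RInt_linear (L : V -> V) (f : R -> V) (a b : R) (I : V) :
  is_linear L -> is_RInt f a b I -> is_RInt (fun s => L (f s)) a b (L I).
Proof.
intros HL HI.
assert (Hc := linear_cont L I HL : filterlim L (locally I) (locally (L I))).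
refine (filterlim_ext _ _ _ (filterlim_comp _ _ _ _ _ _ _ _ HI Hc)).
intros ptd; cbn beta.
etransitivity; [exact (linear_scal _ HL (sign (b - a)) _)|].
apply (f_equal (scal (sign (b - a)))).
induction ptd as [x|h ptd IH] using SF_cons_ind.
- exact (linear_zero L HL).
- rewrite !Riemann_sum_cons, <- IH.
  etransitivity; [exact (linear_plus _ HL _ _)|].
  apply (f_equal (fun z => plus z (L (Riemann_sum f ptd)))).
  exact (linear_scal _ HL (SF_h ptd - fst h) (f (snd h))).
Qed.

Lemma RInt_linear (L : V -> V) (f : R -> V) (a b : R) :
  is_linear L -> ex_RInt f a b ->
  RInt (fun s => L (f s)) a b = L (RInt f a b).
Proof.
intros HL Hf; apply is_RInt_unique, is_RInt_linear; trivial.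
now apply RInt_correct.
Qed.

End LinearMaps.

(** * Strongly continuous families and convolutions *)

Lemma continuous_nonexpansive (p : R -> R) (t : R) :
  (forall s, Rabs (p s - p t) <= Rabs (s - t)) -> continuous p t.
Proof.
intros H; apply (continuous_eps (V := R_NormedModule)); intros eps Heps.
exists eps; split; trivial; intros s Hs.
change (Rabs (p s - p t) < eps); specialize (H s); lra.
Qed.

Lemma continuous_sub_l (c t : R) : continuous (fun s => c - s) t.
Proof.
apply continuous_nonexpansive; intros s.
replace (c - s - (c - t)) with (- (s - t)) by ring.
rewrite Rabs_Ropp; apply Rle_refl.
Qed.

Lemma continuous_sub_r (c t : R) : continuous (fun s => s - c) t.
Proof.
apply continuous_nonexpansive; intros s.
replace (s - c - (t - c)) with (s - t) by ring; apply Rle_refl.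
Qed.

Lemma continuous_max_r (c t : R) : continuous (fun s => Rmax s c) t.
Proof.
apply continuous_nonexpansive; intros s.
unfold Rmax; destruct (Rle_dec s c), (Rle_dec t c); unfold Rabs;
  repeat destruct Rcase_abs; lra.
Qed.

Lemma continuous_min_r (c t : R) : continuous (fun s => Rmin s c) t.
Proof.
apply continuous_nonexpansive; intros s.
unfold Rmin; destruct (Rle_dec s c), (Rle_dec t c); unfold Rabs;
  repeat destruct Rcase_abs; lra.
Qed.

Lemma Rabs_le_between (r s : R) :
  Rmin 0 r <= s <= Rmax 0 r -> Rabs s <= Rabs r /\ Rabs (r - s) <= Rabs r.
Proof.
unfold Rmin, Rmax; destruct (Rle_dec 0 r); intros H;
  split; unfold Rabs; repeat destruct Rcase_abs; lra.
Qed.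

Lemma continuous_comp_real {Y : NormedModule R_AbsRing} (k : R -> Y)
    (p : R -> R) (t : R) :
  continuous p t -> continuous k (p t) -> continuous (fun s => k (p s)) t.
Proof. intros Hp Hk; exact (continuous_comp p k t Hp Hk). Qed.

Section StrongFamilies.

Context {Y : CompleteNormedModule R_AbsRing}.

Lemma uniformly_continuous (k : R -> Y) (a b eps : R) :
  (forall t, continuous k t) -> 0 < eps ->
  exists delta, 0 < delta /\ forall x y, a <= x <= b -> a <= y <= b ->
    Rabs (y - x) < delta -> norm (minus (k y) (k x)) < eps.
Proof.
intros Hk Heps.
assert (Hn := @norm_factor_gt_0 R_AbsRing Y).
assert (He : 0 < eps / norm_factor (V := Y)) by now apply Rdiv_lt_0_compat.
destruct (unifcont_1d k a b (fun x _ => Hk x) (mkposreal _ He)) as [d Hd].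
exists d; split; [apply cond_pos|]; intros x y Hx Hy Hxy.
assert (Hb := NNPP _ (Hd x y Hx Hy Hxy)).
apply (@norm_compat2 R_AbsRing) in Hb.
change (norm (minus (k y) (k x)) < norm_factor (V := Y) *
  (eps / norm_factor (V := Y))) in Hb.
now replace (norm_factor (V := Y) * (eps / norm_factor (V := Y))) with eps in Hb
  by (field; lra).
Qed.

(** The remainder is the integral of [dk z - dk x] from [x] to [y]. *)
Lemma mean_value_bound (k dk : R -> Y) (x y eps : R) :
  (forall t, is_derive k t (dk t)) -> (forall t, continuous dk t) ->
  (forall z, Rmin x y <= z <= Rmax x y -> norm (minus (dk z) (dk x)) <= eps) ->
  norm (minus (minus (k y) (k x)) (scal (y - x) (dk x))) <= Rabs (y - x) * eps.
Proof.
intros Hk Hdk Hz.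
apply (norm_RInt_le_const_abs (fun z => minus (dk z) (dk x)) x y); trivial.
refine (is_RInt_minus _ _ _ _ _ _ _ _); [|exact (is_RInt_const x y (dk x))].
apply (is_RInt_derive k dk); auto.
Qed.

(** Indexed by all of [R] with bounds uniform on half-lines [r <= a]: this fits families that are
    constant or zero at negative times, and it is stable under delays [r - c]. *)
Record strong_family (W : R -> Y -> Y) : Prop := {
  sf_linear : forall r, is_linear (W r);
  sf_bounded : forall a, exists M, 0 < M /\
    forall r x, r <= a -> norm (W r x) <= M * norm x;
  sf_continuous : forall x r, continuous (fun s => W s x) r }.

(** The increment of the vector is absorbed by the bound on [r <= p t + 1], while the increment of
    the operator acts on the fixed vector [k t]. *)
Lemma strong_family_app (W : R -> Y -> Y) (p : R -> R) (k : R -> Y) (t : R) :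
  strong_family W -> continuous p t -> continuous k t ->
  continuous (fun s => W (p s) (k s)) t.
Proof.
intros HW Hp Hk.
refine (proj2 (continuous_eps (fun s => W (p s) (k s)) t) _); intros eps Heps.
destruct (sf_bounded W HW (p t + 1)) as (M & HM & HMb).
destruct (proj1 (continuous_eps (V := R_NormedModule) p t) Hp 1 Rlt_0_1)
  as (d1 & Hd1 & H1).
assert (Hp2 : 0 < eps / (2 * M)) by (apply Rdiv_lt_0_compat; lra).
destruct (proj1 (continuous_eps k t) Hk _ Hp2) as (d2 & Hd2 & H2).
assert (Hc := continuous_comp_real (fun r => W r (k t)) p t Hp
  (sf_continuous W HW (k t) (p t))).
destruct (proj1 (continuous_eps _ t) Hc (eps / 2) ltac:(lra))
  as (d3 & Hd3 & H3).
exists (Rmin d1 (Rmin d2 d3)); split; [repeat apply Rmin_pos; trivial|].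
intros s Hs; cbn beta.
assert (Hm1 := Rmin_l d1 (Rmin d2 d3)); assert (Hm2 := Rmin_r d1 (Rmin d2 d3)).
assert (Hm3 := Rmin_l d2 d3); assert (Hm4 := Rmin_r d2 d3).
specialize (H1 s ltac:(lra)); specialize (H2 s ltac:(lra));
  specialize (H3 s ltac:(lra)).
change (norm (minus (k s) (k t)) < eps / (2 * M)) in H2.
change (norm (minus (W (p s) (k t)) (W (p t) (k t))) < eps / 2) in H3.
change (Rabs (p s - p t) < 1) in H1; apply Rabs_def2 in H1.
norm_as (plus (W (p s) (minus (k s) (k t)))
    (minus (W (p s) (k t)) (W (p t) (k t))))
  by (rewrite (linear_minus (W (p s)) _ _ (sf_linear W HW (p s))); module_eq).
norm_tri.
assert (H4 := HMb (p s) (minus (k s) (k t)) ltac:(lra)).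
assert (M * norm (minus (k s) (k t)) < eps / 2).
{ apply Rlt_le_trans with (M * (eps / (2 * M)));
    [now apply Rmult_lt_compat_l|right; field; lra]. }
lra.
Qed.

Lemma strong_family_comp (W : R -> Y -> Y) (B : Y -> Y) :
  strong_family W -> is_linear B -> strong_family (fun r x => B (W r x)).
Proof.
intros HW HB; split.
- intros r; exact (is_linear_comp _ _ (sf_linear W HW r) HB).
- intros a; destruct (sf_bounded W HW a) as (M & HM & HMb).
  destruct (linear_norm _ HB) as (C & HC & HCb).
  exists (C * M); split; [now apply Rmult_lt_0_compat|]; intros r x Hr.
  eapply Rle_trans; [apply HCb|]; rewrite Rmult_assoc.
  apply Rmult_le_compat_l; [lra|auto].
- intros x r; apply (continuous_comp (fun s => W s x) B);
    [now apply sf_continuous|exact (linear_cont B (W r x) HB)].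
Qed.

Lemma strong_family_shift (W : R -> Y -> Y) (c : R) :
  0 <= c -> strong_family W -> strong_family (fun r x => W (r - c) x).
Proof.
intros Hc HW; split.
- intros r; apply (sf_linear W HW).
- intros a; destruct (sf_bounded W HW a) as (M & HM & HMb).
  exists M; split; trivial; intros r x Hr; apply HMb; lra.
- intros x r; apply (continuous_comp_real (fun s => W s x));
    [apply continuous_sub_r|now apply sf_continuous].
Qed.

Lemma strong_family_plus (W W' : R -> Y -> Y) :
  strong_family W -> strong_family W' ->
  strong_family (fun r x => plus (W r x) (W' r x)).
Proof.
intros HW HW'; split.
- intros r; split.
  + intros x y; rewrite (linear_plus _ (sf_linear W HW r)),
      (linear_plus _ (sf_linear W' HW' r)); module_eq.
  + intros c x.
    transitivity (plus (scal c (W r x)) (scal c (W' r x))); [|module_eq].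
    f_equal; [exact (linear_scal _ (sf_linear W HW r) c x)|
      exact (linear_scal _ (sf_linear W' HW' r) c x)].
  + destruct (linear_norm _ (sf_linear W HW r)) as (M & HM & H).
    destruct (linear_norm _ (sf_linear W' HW' r)) as (M' & HM' & H').
    exists (M + M'); split; [lra|]; intros x; norm_tri.
    specialize (H x); specialize (H' x); lra.
- intros a; destruct (sf_bounded W HW a) as (M & HM & H).
  destruct (sf_bounded W' HW' a) as (M' & HM' & H').
  exists (M + M'); split; [lra|]; intros r x Hr; norm_tri.
  specialize (H r x Hr); specialize (H' r x Hr); lra.
- intros x r; apply (continuous_plus (fun s => W s x) (fun s => W' s x));
    now apply sf_continuous.
Qed.

Lemma ex_RInt_strong_family (W : R -> Y -> Y) (k : R -> Y) (a b : R) :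
  strong_family W -> (forall t, continuous k t) ->
  ex_RInt (fun s => W s (k s)) a b.
Proof.
intros HW Hk; apply ex_RInt_continuous; intros s _.
apply (strong_family_app W (fun s => s)); trivial; apply continuous_id.
Qed.

(** The variable [r] sits in the argument of [k] and in the upper limit, so that differentiation
    never falls on the operators. *)
Definition conv (W : R -> Y -> Y) (k : R -> Y) (r : R) : Y :=
  RInt (fun s => W s (k (r - s))) 0 r.

Lemma continuous_reflect (k : R -> Y) (c : R) :
  (forall t, continuous k t) -> forall t, continuous (fun s => k (c - s)) t.
Proof.
intros Hk t; exact (continuous_comp_real k (fun s => c - s) t
  (continuous_sub_l c t) (Hk (c - t))).
Qed.

Lemma is_RInt_conv (W : R -> Y -> Y) (k : R -> Y) (r : R) :
  strong_family W -> (forall t, continuous k t) ->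
  is_RInt (fun s => W s (k (r - s))) 0 r (conv W k r).
Proof.
intros HW Hk; apply RInt_correct.
exact (ex_RInt_strong_family W (fun s => k (r - s)) 0 r HW
  (continuous_reflect k r Hk)).
Qed.

Lemma conv_increment (W : R -> Y -> Y) (k : R -> Y) (r r' : R) :
  strong_family W -> (forall t, continuous k t) ->
  minus (conv W k r') (conv W k r) =
  plus (RInt (fun s => minus (W s (k (r' - s))) (W s (k (r - s)))) 0 r)
    (RInt (fun s => W s (k (r' - s))) r r').
Proof.
intros HW Hk; unfold conv.
assert (Hex : forall c a b, ex_RInt (fun s => W s (k (c - s))) a b)
  by (intros c a b; exact (ex_RInt_strong_family W (fun s => k (c - s)) a b HW
        (continuous_reflect k c Hk))).
rewrite (RInt_minus (fun s => W s (k (r' - s))) (fun s => W s (k (r - s))))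
  by apply Hex.
rewrite <- (RInt_Chasles (fun s => W s (k (r' - s))) 0 r r') by apply Hex.
module_eq.
Qed.

Lemma continuous_conv (W : R -> Y -> Y) (k : R -> Y) (r : R) :
  strong_family W -> (forall t, continuous k t) -> continuous (conv W k) r.
Proof.
intros HW Hk; refine (proj2 (continuous_eps (conv W k) r) _); intros eps Heps.
(* For [|r' - r| < 1] all arguments of [k] lie in [[-a, a]] and all operator times are at most [a].
   The constants [e] and [e2] below make each of the two parts of the increment smaller than
   [eps / 2]. *)
set (a := Rabs r + 1).
assert (Ha : 0 <= Rabs r) by apply Rabs_pos.
destruct (sf_bounded W HW a) as (M & HM & HMb).
set (e := eps / (2 * M * a)).
assert (HMa : 0 < 2 * M * a) by (apply Rmult_lt_0_compat; unfold a; lra).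
assert (He : 0 < e) by now apply Rdiv_lt_0_compat.
destruct (uniformly_continuous k (- a) a e Hk He) as (d1 & Hd1 & H1).
destruct (uniformly_continuous k (- a) a 1 Hk Rlt_0_1) as (d2 & Hd2 & H2).
assert (Hn0 := norm_ge_0 (k 0)).
set (e2 := eps / (2 * M * (1 + norm (k 0)))).
assert (HMk : 0 < 2 * M * (1 + norm (k 0))) by (apply Rmult_lt_0_compat; lra).
assert (He2 : 0 < e2) by now apply Rdiv_lt_0_compat.
exists (Rmin (Rmin d1 d2) (Rmin 1 e2)); split; [repeat apply Rmin_pos; lra|].
intros r' Hr'.
assert (Hm : Rabs (r' - r) < d1 /\ Rabs (r' - r) < d2 /\ Rabs (r' - r) < 1 /\
  Rabs (r' - r) < e2).
{ assert (Hm1 := Rmin_l (Rmin d1 d2) (Rmin 1 e2)).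
  assert (Hm2 := Rmin_r (Rmin d1 d2) (Rmin 1 e2)).
  assert (Hm3 := Rmin_l d1 d2); assert (Hm4 := Rmin_r d1 d2).
  assert (Hm5 := Rmin_l 1 e2); assert (Hm6 := Rmin_r 1 e2).
  repeat split; lra. }
destruct Hm as (Hm1 & Hm2 & Hm3 & Hm4); apply Rabs_def2 in Hm3 as Hm5.
assert (Hra := Rle_abs r); assert (Hra' := Rle_abs (- r)).
rewrite Rabs_Ropp in Hra'.
norm_as (plus
    (RInt (fun s => minus (W s (k (r' - s))) (W s (k (r - s)))) 0 r)
    (RInt (fun s => W s (k (r' - s))) r r'))
  by exact (conv_increment W k r r' HW Hk).
norm_tri.
assert (I1 : norm (RInt (fun s => minus (W s (k (r' - s))) (W s (k (r - s)))) 0 r)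
  <= Rabs (r - 0) * (M * e)).
{ apply (norm_RInt_le_const_abs
    (fun s => minus (W s (k (r' - s))) (W s (k (r - s)))) 0 r).
  - intros s Hs; apply Rabs_le_between in Hs as [Hs1 Hs2].
    assert (Hs3 := Rle_abs s).
    assert (Hs4 := Rle_abs (r - s)); assert (Hs5 := Rle_abs (- (r - s))).
    rewrite Rabs_Ropp in Hs5.
    norm_as (W s (minus (k (r' - s)) (k (r - s))))
      by (symmetry; exact (linear_minus (W s) _ _ (sf_linear W HW s))).
    eapply Rle_trans; [apply HMb; unfold a; lra|].
    apply Rmult_le_compat_l; [lra|]; apply Rlt_le, H1; unfold a; try lra.
    now replace (r' - s - (r - s)) with (r' - r) by ring.
  - apply RInt_correct, @ex_RInt_minus.
    + apply (ex_RInt_strong_family W (fun s => k (r' - s))); trivial.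
      now apply continuous_reflect.
    + apply (ex_RInt_strong_family W (fun s => k (r - s))); trivial.
      now apply continuous_reflect. }
assert (I2 : norm (RInt (fun s => W s (k (r' - s))) r r')
  <= Rabs (r' - r) * (M * (1 + norm (k 0)))).
{ apply (norm_RInt_le_const_abs (fun s => W s (k (r' - s))) r r').
  - intros s Hs.
    assert (Hs' : Rabs (r' - s) <= Rabs (r' - r) /\ s <= a).
    { revert Hs; unfold Rmin, Rmax, a; destruct (Rle_dec r r'); intros Hs;
        (split; [|lra]); unfold Rabs; repeat destruct Rcase_abs; lra. }
    destruct Hs' as [Hs1 Hs2].
    eapply Rle_trans; [now apply HMb|].
    apply Rmult_le_compat_l; [lra|].
    replace (k (r' - s)) with (plus (minus (k (r' - s)) (k 0)) (k 0)) by module_eq.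
    norm_tri; apply Rplus_le_compat_r, Rlt_le, H2; unfold a; try lra.
    + assert (Hs4 := Rle_abs (r' - s)); assert (Hs5 := Rle_abs (- (r' - s))).
      rewrite Rabs_Ropp in Hs5; lra.
    + rewrite Rminus_0_r; lra.
  - apply RInt_correct, (ex_RInt_strong_family W (fun s => k (r' - s))); trivial.
    now apply continuous_reflect. }
rewrite Rminus_0_r in I1.
assert (E1 : Rabs r * (M * e) < eps / 2).
{ apply Rlt_le_trans with (a * (M * e)).
  - apply Rmult_lt_compat_r; [now apply Rmult_lt_0_compat|unfold a; lra].
  - right; unfold e; field; split; unfold a; lra. }
assert (E2 : Rabs (r' - r) * (M * (1 + norm (k 0))) < eps / 2).
{ apply Rlt_le_trans with (e2 * (M * (1 + norm (k 0)))).
  - apply Rmult_lt_compat_r; lra.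
  - right; unfold e2; field; split; lra. }
lra.
Qed.

(** The moving upper limit yields [W r (k 0)]; under the integral sign the mean value bound makes
    the difference quotients of [k] converge uniformly, by uniform continuity of [dk]. *)
Lemma is_derive_conv (W : R -> Y -> Y) (k dk : R -> Y) (r : R) :
  strong_family W -> (forall t, is_derive k t (dk t)) ->
  (forall t, continuous dk t) ->
  is_derive (conv W k) r (plus (W r (k 0)) (conv W dk r)).
Proof.
intros HW Hk Hdk.
assert (Hkc : forall t, continuous k t).
{ intros t; refine (ex_derive_continuous k t _); exists (dk t); apply Hk. }
refine (proj2 (is_derive_eps (conv W k) r _) _); intros eps Heps.
set (a := Rabs r + 1).
assert (Ha : 0 <= Rabs r) by apply Rabs_pos.
destruct (sf_bounded W HW a) as (M & HM & HMb).
set (e := eps / (2 * M * a)).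
assert (HMa : 0 < 2 * M * a) by (apply Rmult_lt_0_compat; unfold a; lra).
assert (He : 0 < e) by now apply Rdiv_lt_0_compat.
destruct (uniformly_continuous dk (- a) a e Hdk He) as (d1 & Hd1 & H1).
assert (HMp : 0 < eps / (4 * M)) by (apply Rdiv_lt_0_compat; lra).
destruct (proj1 (continuous_eps k 0) (Hkc 0) (eps / (4 * M)) HMp)
  as (d2 & Hd2 & H2).
destruct (proj1 (continuous_eps _ r) (sf_continuous W HW (k 0) r) (eps / 4)
  ltac:(lra)) as (d3 & Hd3 & H3).
exists (Rmin (Rmin d1 d2) (Rmin 1 d3)); split; [repeat apply Rmin_pos; lra|].
intros r' Hr'.
assert (Hm : Rabs (r' - r) < d1 /\ Rabs (r' - r) < d2 /\ Rabs (r' - r) < 1 /\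
  Rabs (r' - r) < d3).
{ assert (Hm1 := Rmin_l (Rmin d1 d2) (Rmin 1 d3)).
  assert (Hm2 := Rmin_r (Rmin d1 d2) (Rmin 1 d3)).
  assert (Hm3 := Rmin_l d1 d2); assert (Hm4 := Rmin_r d1 d2).
  assert (Hm5 := Rmin_l 1 d3); assert (Hm6 := Rmin_r 1 d3).
  repeat split; lra. }
destruct Hm as (Hm1 & Hm2 & Hm3 & Hm4); apply Rabs_def2 in Hm3 as Hm5.
assert (Hra := Rle_abs r); assert (Hra' := Rle_abs (- r)).
rewrite Rabs_Ropp in Hra'.
assert (EJ := conv_increment W k r r' HW Hkc).
set (J1 := RInt (fun s => minus (W s (k (r' - s))) (W s (k (r - s)))) 0 r) in *.
set (J2 := RInt (fun s => W s (k (r' - s))) r r') in *.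
assert (HJ1 : is_RInt (fun s => minus (W s (k (r' - s))) (W s (k (r - s))))
  0 r J1).
{ apply RInt_correct, @ex_RInt_minus.
  - apply (ex_RInt_strong_family W (fun s => k (r' - s))); trivial.
    now apply continuous_reflect.
  - apply (ex_RInt_strong_family W (fun s => k (r - s))); trivial.
    now apply continuous_reflect. }
assert (HJ2 : is_RInt (fun s => W s (k (r' - s))) r r' J2).
{ apply RInt_correct, (ex_RInt_strong_family W (fun s => k (r' - s))); trivial.
  now apply continuous_reflect. }
norm_as (plus (minus J1 (scal (r' - r) (conv W dk r)))
    (minus J2 (scal (r' - r) (W r (k 0)))))
  by (etransitivity; [exact (f_equal (fun z => minus z
        (scal (r' - r) (plus (W r (k 0)) (conv W dk r)))) EJ)|module_eq]).
norm_tri.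
assert (I1 : norm (minus J1 (scal (r' - r) (conv W dk r))) <=
  Rabs (r - 0) * (M * (Rabs (r' - r) * e))).
{ apply (norm_RInt_le_const_abs
    (fun s => minus (minus (W s (k (r' - s))) (W s (k (r - s))))
       (scal (r' - r) (W s (dk (r - s))))) 0 r).
  - intros s Hs; apply Rabs_le_between in Hs as [Hs1 Hs2].
    assert (Hs3 := Rle_abs s).
    assert (Hs4 := Rle_abs (r - s)); assert (Hs5 := Rle_abs (- (r - s))).
    rewrite Rabs_Ropp in Hs5.
    norm_as (W s (minus (minus (k (r' - s)) (k (r - s)))
        (scal ((r' - s) - (r - s)) (dk (r - s)))))
      by (rewrite !(linear_minus (W s)) by apply (sf_linear W HW);
        replace (r' - s - (r - s)) with (r' - r) by ring;
        apply (f_equal (minus _)); symmetry;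
        exact (linear_scal _ (sf_linear W HW s) (r' - r) (dk (r - s)))).
    eapply Rle_trans; [apply HMb; unfold a; lra|].
    apply Rmult_le_compat_l; [lra|].
    replace (Rabs (r' - r)) with (Rabs ((r' - s) - (r - s))) by (f_equal; ring).
    apply mean_value_bound; trivial; intros z Hz; apply Rlt_le, H1.
    + unfold a; lra.
    + revert Hz; unfold a, Rmin, Rmax; destruct Rle_dec; lra.
    + eapply Rle_lt_trans; [|exact Hm1].
      revert Hz; unfold Rmin, Rmax; destruct Rle_dec; intros Hz; unfold Rabs;
        repeat destruct Rcase_abs; lra.
  - refine (is_RInt_minus _ _ _ _ _ _ _ _); [exact HJ1|].
    exact (is_RInt_scal _ 0 r (r' - r) _ (is_RInt_conv W dk r HW Hdk)). }
assert (I2 : norm (minus J2 (scal (r' - r) (W r (k 0)))) <=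
  Rabs (r' - r) * (eps / 2)).
{ apply (norm_RInt_le_const_abs
    (fun s => minus (W s (k (r' - s))) (W r (k 0))) r r').
  - intros s Hs.
    assert (Hs' : Rabs (r' - s) <= Rabs (r' - r) /\ s <= a /\
      Rabs (s - r) <= Rabs (r' - r)).
    { revert Hs; unfold Rmin, Rmax, a; destruct (Rle_dec r r'); intros Hs;
        (split; [|split; [lra|]]); unfold Rabs; repeat destruct Rcase_abs; lra. }
    destruct Hs' as (Hs1 & Hs2 & Hs3).
    norm_as (plus (W s (minus (k (r' - s)) (k 0)))
        (minus (W s (k 0)) (W r (k 0))))
      by (rewrite (linear_minus (W s)) by apply (sf_linear W HW); module_eq).
    norm_tri.
    assert (N1 : norm (W s (minus (k (r' - s)) (k 0))) <= eps / 4).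
    { eapply Rle_trans; [now apply HMb|].
      apply Rle_trans with (M * (eps / (4 * M))); [|right; field; lra].
      apply Rmult_le_compat_l; [lra|]; apply Rlt_le, H2.
      rewrite Rminus_0_r; lra. }
    specialize (H3 s ltac:(lra)).
    change (norm (minus (W s (k 0)) (W r (k 0))) < eps / 4) in H3; lra.
  - refine (is_RInt_minus _ _ _ _ _ _ _ _); [exact HJ2|exact (is_RInt_const r r' (W r (k 0)))]. }
rewrite Rminus_0_r in I1.
assert (Hp := Rabs_pos (r' - r)).
assert (E1 : Rabs r * (M * (Rabs (r' - r) * e)) <= Rabs (r' - r) * (eps / 2)).
{ apply Rle_trans with (a * (M * (Rabs (r' - r) * e))).
  - apply Rmult_le_compat_r; [|unfold a; lra].
    apply Rmult_le_pos; [lra|apply Rmult_le_pos; lra].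
  - right; unfold e; field; split; unfold a; lra. }
lra.
Qed.

End StrongFamilies.

(** * Semigroups and generators *)

Section Integrals.

Context {Y : CompleteNormedModule R_AbsRing}.

Lemma is_RInt_shift (g : R -> Y) (a b c : R) (l : Y) :
  is_RInt g (a + c) (b + c) l -> is_RInt (fun s => g (s + c)) a b l.
Proof.
intros H; apply (is_RInt_ext (fun s => scal 1 (g (1 * s + c)))).
- intros s _; replace (1 * s + c) with (s + c) by ring; module_eq.
- apply (is_RInt_comp_lin g 1 c a b l); now rewrite !Rmult_1_l.
Qed.

Lemma is_RInt_reflect (g : R -> Y) (a b c : R) (l : Y) :
  is_RInt g (c - b) (c - a) l -> is_RInt (fun s => g (c - s)) a b l.
Proof.
intros H; apply (is_RInt_ext (fun s => opp (scal (-1) (g (-1 * s + c))))).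
- intros s _; replace (-1 * s + c) with (c - s) by ring; module_eq.
- replace l with (opp (opp l)) by module_eq.
  refine (is_RInt_opp (fun s => scal (-1) (g (-1 * s + c))) a b (opp l) _).
  apply (is_RInt_comp_lin g (-1) c a b (opp l)).
  replace (-1 * a + c) with (c - a) by ring.
  replace (-1 * b + c) with (c - b) by ring.
  exact (is_RInt_swap g (c - a) (c - b) l H).
Qed.

Lemma continuous_clamp (f : R -> Y) (a b t : R) :
  a <= b -> continuous_on (fun s => a <= s <= b) f ->
  continuous (fun s => f (Rmax (Rmin s b) a)) t.
Proof.
intros Hab Hf.
assert (Hclamp : forall t, a <= Rmax (Rmin t b) a <= b).
{ intros s; unfold Rmax, Rmin; repeat destruct Rle_dec; lra. }
refine (proj2 (continuous_eps (fun s => f (Rmax (Rmin s b) a)) t) _).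
intros eps Heps.
destruct (proj1 (continuous_on_eps _ _) Hf _ (Hclamp t) eps Heps)
  as (d & Hd & Hs).
exists d; split; trivial; intros s Hst; apply Hs; trivial.
eapply Rle_lt_trans; [|exact Hst].
unfold Rmax, Rmin; repeat destruct Rle_dec; unfold Rabs;
  repeat destruct Rcase_abs; lra.
Qed.

(** [df] is continued by its endpoint values and integrated from [f a]; the one-sided derivatives of
    [f] identify this integral with [f] on [[a, b]]. *)
Lemma C1_extension (a b : R) (f df : R -> Y) :
  a <= b -> C1_on (fun t => a <= t <= b) f df ->
  exists F dF : R -> Y,
    (forall t, is_derive F t (dF t)) /\ (forall t, continuous dF t) /\
    forall t, a <= t <= b -> F t = f t /\ dF t = df t.
Proof.
intros Hab Hf; assert (Hfc := C1_on_continuous_on _ _ _ Hf).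
destruct Hf as [Hf Hdf].
set (clamp := fun t => Rmax (Rmin t b) a).
assert (Hid : forall t, a <= t <= b -> clamp t = t).
{ intros t Ht; unfold clamp, Rmax, Rmin; repeat destruct Rle_dec; lra. }
set (dF := fun t => df (clamp t)).
assert (HdF : forall t, continuous dF t)
  by (intros t; exact (continuous_clamp df a b t Hab Hdf)).
assert (Hex : forall u v, ex_RInt dF u v)
  by (intros u v; apply ex_RInt_continuous; auto).
exists (fun t => plus (f a) (RInt dF a t)), dF.
split; [|split; [exact HdF|intros t Ht; split]].
- intros t; refine (proj2 (is_derive_eps _ t _) _); intros eps Heps.
  assert (Hd : is_derive (fun t => RInt dF a t) t (dF t)).
  { refine (is_derive_RInt dF (fun t => RInt dF a t) a t _ (HdF t)).
    exists (mkposreal 1 Rlt_0_1); intros y _; now apply RInt_correct. }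
  destruct (proj1 (is_derive_eps _ _ _) Hd eps Heps) as (d & Hd0 & Hs).
  exists d; split; trivial; intros s Hst.
  norm_as (minus (minus (RInt dF a s) (RInt dF a t)) (scal (s - t) (dF t)))
    by module_eq.
  now apply Hs.
- assert (HI : is_RInt dF a t (minus (f t) (f a))).
  { apply (is_RInt_derive_within f dF a t nil); [lra| | |apply Hex].
    - intros s Hs; apply (continuous_on_loc (fun s => a <= s <= b)
        (fun s => a <= s <= t) f f); trivial; [|apply Hfc; lra].
      exists 1; split; [lra|]; intros u Hu _; split; [lra|easy].
    - intros s Hs _; unfold dF; rewrite Hid by lra.
      apply (is_derive_within_loc (fun s => a <= s <= b)
        (fun s => a <= s <= t) f f); trivial; try lra; [|apply Hf; lra].
      exists 1; split; [lra|]; intros u Hu _; split; [lra|easy]. }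
  rewrite (is_RInt_unique _ _ _ _ HI); module_eq.
- unfold dF; now rewrite Hid by lra.
Qed.

End Integrals.

Lemma bounded_of_eventually_bounded (u : nat -> R) (N : nat) (B : R) :
  (forall n, (N <= n)%nat -> u n <= B) -> exists B', forall n, u n <= B'.
Proof.
revert B; induction N as [|N IH]; intros B H; [exists B; intros; apply H; lia|].
apply (IH (Rmax B (u N))); intros n Hn.
destruct (Nat.eq_dec n N) as [->|Hne]; [apply Rmax_r|].
eapply Rle_trans; [apply H; lia|apply Rmax_l].
Qed.

Section Semigroups.

Context {Y : CompleteNormedModule R_AbsRing}.

Record real_semigroup (T : R -> Y -> Y) (D0 : Y -> Prop) (A0 : Y -> Y) : Prop := {
  sg_linear : forall t, 0 <= t -> is_linear (T t);
  sg_zero : forall x, T 0 x = x;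
  sg_add : forall t s x, 0 <= t -> 0 <= s -> T (t + s) x = T t (T s x);
  sg_continuous : forall x, filterlim (fun t => T t x) (at_right 0) (locally x);
  sg_generator : forall x y, (D0 x /\ A0 x = y) <->
    filterlim (fun h => scal (/ h) (minus (T h x) x)) (at_right 0) (locally y) }.

Context (T : R -> Y -> Y) (D0 : Y -> Prop) (A0 : Y -> Y).
Context (HT : real_semigroup T D0 A0).

Lemma sg_continuous_zero (x : Y) (eps : R) : 0 < eps ->
  exists delta, 0 < delta /\
    forall h, 0 <= h < delta -> norm (minus (T h x) x) < eps.
Proof.
intros Heps.
destruct (proj1 (filterlim_within_eps (fun t => 0 < t) _ 0 x)
  (sg_continuous T D0 A0 HT x) eps Heps) as (d & Hd & Hs).
exists d; split; trivial; intros h Hh.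
destruct (Req_dec h 0) as [->|Hn].
- rewrite (sg_zero T D0 A0 HT).
  replace (minus x x) with (@zero Y) by module_eq; norm_zero_eq; lra.
- apply Hs; [lra|]; rewrite Rminus_0_r, Rabs_pos_eq; lra.
Qed.

(** Otherwise there are times [t_n <= 1 / (n + 1)] with operators [T t_n] of unbounded norm. Strong
    continuity at 0 bounds them pointwise, against the uniform boundedness principle. *)
Lemma semigroup_bounded_near_zero : exists d M, 0 < d /\ 0 < M /\
  forall t x, 0 <= t <= d -> norm (T t x) <= M * norm x.
Proof.
apply NNPP; intros Hn.
assert (Hbad : forall n : nat, exists tx : R * Y,
  0 <= fst tx <= / (INR n + 1) /\
  (INR n + 1) * norm (snd tx) < norm (T (fst tx) (snd tx))).
{ intros n; apply NNPP; intros Hc; apply Hn.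
  assert (Hp := pos_INR n).
  exists (/ (INR n + 1)), (INR n + 1); split;
    [apply Rinv_0_lt_compat; lra|split; [lra|]].
  intros t x Ht; apply Rnot_lt_le; intros Hlt; apply Hc; now exists (t, x). }
destruct (functional_choice _ Hbad) as [tx Htx].
assert (Ht0 : forall n, 0 <= fst (tx n)) by (intros n; apply Htx).
destruct (uniform_boundedness (fun n => T (fst (tx n)))) as (M & HM & HMb).
- intros n; now apply (sg_linear T D0 A0 HT).
- intros x; destruct (sg_continuous_zero x 1 Rlt_0_1) as (d & Hd & Hs).
  destruct (INR_unbounded (/ d)) as [N HN].
  apply (bounded_of_eventually_bounded _ N (1 + norm x)); intros n Hn'.
  replace (T (fst (tx n)) x) with (plus (minus (T (fst (tx n)) x) x) x)
    by module_eq.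
  norm_tri; apply Rplus_le_compat_r, Rlt_le, Hs; split; [apply Ht0|].
  eapply Rle_lt_trans; [apply Htx|].
  rewrite <- (Rinv_inv d); apply Rinv_lt_contravar.
  + apply Rmult_lt_0_compat; [now apply Rinv_0_lt_compat|].
    assert (Hp := pos_INR n); lra.
  + apply le_INR in Hn'; lra.
- destruct (INR_unbounded M) as [n Hn'].
  destruct (Htx n) as [_ Hlt]; specialize (HMb n (snd (tx n))); cbn beta in HMb.
  assert (Hp := norm_ge_0 (snd (tx n))); nra.
Qed.

(** Induction over multiples of [d]: the semigroup law splits off a time at most [d] at the cost of
    a factor [M], and [M * C + C] dominates both cases. *)
Lemma semigroup_bounded (a : R) : exists M, 0 < M /\
  forall t x, 0 <= t <= a -> norm (T t x) <= M * norm x.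
Proof.
destruct semigroup_bounded_near_zero as (d & M & Hd & HM & HMb).
assert (Hk : forall k, exists C, 0 < C /\
  forall t x, 0 <= t <= INR k * d -> norm (T t x) <= C * norm x).
{ induction k as [|k (C & HC & HCb)].
  - exists 1; split; [lra|]; intros t x Ht; cbn in Ht.
    replace t with 0 by lra; rewrite (sg_zero T D0 A0 HT); lra.
  - exists (M * C + C); split; [nra|]; intros t x Ht; rewrite S_INR in Ht.
    assert (Hp := norm_ge_0 x).
    destruct (Rle_dec t (INR k * d)) as [Hle|Hgt].
    + eapply Rle_trans; [apply HCb; lra|].
      apply Rmult_le_compat_r; trivial; nra.
    + assert (Hkd : 0 <= INR k * d) by (apply Rmult_le_pos; [apply pos_INR|lra]).
      replace t with ((t - INR k * d) + INR k * d) by ring.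
      rewrite (sg_add T D0 A0 HT) by lra.
      eapply Rle_trans; [apply HMb; lra|].
      specialize (HCb (INR k * d) x ltac:(lra)).
      apply Rle_trans with (M * (C * norm x));
        [apply Rmult_le_compat_l; lra|].
      nra. }
destruct (INR_unbounded (a / d)) as [k Hk'].
destruct (Hk k) as (C & HC & HCb); exists C; split; trivial.
intros t x Ht; apply HCb; split; [lra|].
apply (Rmult_gt_compat_r d) in Hk'; trivial.
replace (a / d * d) with a in Hk' by (field; lra); lra.
Qed.

Definition orbit_family (r : R) (x : Y) : Y := T (Rmax r 0) x.

Lemma orbit_family_pos (r : R) (x : Y) : 0 <= r -> orbit_family r x = T r x.
Proof. intros Hr; unfold orbit_family; now rewrite Rmax_left. Qed.

Lemma strong_family_orbit : strong_family orbit_family.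
Proof.
unfold orbit_family; split.
- intros r; apply (sg_linear T D0 A0 HT), Rmax_r.
- intros a; destruct (semigroup_bounded (Rmax a 0)) as (M & HM & HMb).
  exists M; split; trivial; intros r x Hr; apply HMb; split; [apply Rmax_r|].
  now apply Rle_max_compat_r.
- intros x r; refine (proj2 (continuous_eps (fun s => T (Rmax s 0) x) r) _).
  intros eps Heps; destruct (semigroup_bounded (Rmax (r + 1) 0)) as (M & HM & HMb).
  assert (He : 0 < eps / M) by now apply Rdiv_lt_0_compat.
  destruct (sg_continuous_zero x (eps / M) He) as (d & Hd & Hs).
  exists (Rmin 1 d); split; [now apply Rmin_pos; lra|]; intros s Hsr.
  assert (Hm1 := Rmin_l 1 d); assert (Hm2 := Rmin_r 1 d).
  (* From either side the increment is, up to sign, [T u (T v x - x)] with [v] small, so continuity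
     everywhere reduces to right continuity at 0. *)
  assert (Hb : forall u v, 0 <= u <= Rmax (r + 1) 0 -> 0 <= v < d ->
    norm (minus (T (u + v) x) (T u x)) < eps).
  { intros u v Hu Hv; rewrite (sg_add T D0 A0 HT) by lra.
    norm_as (T u (minus (T v x) x)) by (symmetry;
      apply linear_minus, (sg_linear T D0 A0 HT); lra).
    eapply Rle_lt_trans; [now apply HMb|].
    apply Rlt_le_trans with (M * (eps / M)); [|right; field; lra].
    now apply Rmult_lt_compat_l, Hs. }
  assert (Hsr' := Rabs_def2 _ _ Hsr).
  assert (Hmr : r <= Rmax r 0 /\ 0 <= Rmax r 0 <= Rmax (r + 1) 0 /\
    0 <= Rmax s 0 <= Rmax (r + 1) 0 /\ Rabs (Rmax s 0 - Rmax r 0) < d).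
  { assert (Rabs (Rmax s 0 - Rmax r 0) <= Rabs (s - r)).
    { unfold Rmax; repeat destruct Rle_dec; unfold Rabs;
        repeat destruct Rcase_abs; lra. }
    repeat split; try apply Rmax_l; try apply Rmax_r; try lra;
      apply Rle_max_compat_r; lra. }
  destruct Hmr as (Hm3 & Hm4 & Hm5 & Hm6); apply Rabs_def2 in Hm6.
  set (u := Rmax s 0) in *; set (v := Rmax r 0) in *.
  destruct (Rle_dec v u).
  + replace u with (v + (u - v)) by ring; apply Hb; lra.
  + norm_as (opp (minus (T v x) (T u x))) by module_eq.
    norm_opp_eq; replace v with (u + (v - u)) by ring; apply Hb; lra.
Qed.

Lemma generator_eps (x y : Y) :
  (D0 x /\ A0 x = y) <->
  forall eps, 0 < eps -> exists delta, 0 < delta /\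
    forall h, 0 < h < delta ->
      norm (minus (minus (T h x) x) (scal h y)) <= eps * h.
Proof.
assert (Es : forall h, 0 < h ->
  norm (minus (minus (T h x) x) (scal h y)) =
  h * norm (minus (scal (/ h) (minus (T h x) x)) y)).
{ intros h Hh.
  replace (minus (minus (T h x) x) (scal h y)) with
    (scal h (minus (scal (/ h) (minus (T h x) x)) y)) by (module_field; lra).
  norm_scal_eq; rewrite Rabs_pos_eq; lra. }
rewrite (sg_generator T D0 A0 HT).
split.
- intros H eps Heps.
  destruct (proj1 (filterlim_within_eps (fun t => 0 < t) _ 0 y) H eps Heps)
    as (d & Hd & Hs).
  exists d; split; trivial; intros h Hh; rewrite Es by lra.
  specialize (Hs h ltac:(lra)
    ltac:(rewrite Rminus_0_r, Rabs_pos_eq; lra)).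
  rewrite Rmult_comm; apply Rmult_le_compat_r; [lra|]; apply Rlt_le, Hs.
- intros H; refine (proj2 (filterlim_within_eps (fun t => 0 < t)
    (fun h => scal (/ h) (minus (T h x) x)) 0 y) _); intros eps Heps.
  destruct (H (eps / 2) ltac:(lra)) as (d & Hd & Hs).
  exists d; split; trivial; intros h Hh Hhd.
  rewrite Rminus_0_r, Rabs_pos_eq in Hhd by lra.
  specialize (Hs h ltac:(lra)); rewrite Es in Hs by lra.
  change (norm (minus (scal (/ h) (minus (T h x) x)) y) < eps).
  apply (Rmult_lt_reg_l h); [lra|].
  eapply Rle_lt_trans; [exact Hs|]; nra.
Qed.

(** [T] at the earlier time is applied to the remainder at 0. To the right this is the claim; to the
    left it produces [T s (A0 x)], which strong continuity exchanges for [T t (A0 x)]. *)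
Lemma is_derive_orbit (x : Y) (t : R) : D0 x -> 0 <= t ->
  is_derive_within (fun s => 0 <= s) (fun s => T s x) t (T t (A0 x)).
Proof.
intros Dx Ht; refine (proj2 (is_derive_within_eps (fun s => 0 <= s) _ t _ Ht) _).
intros eps Heps.
destruct (semigroup_bounded (t + 1)) as (M & HM & HMb).
assert (He : 0 < eps / (2 * M)) by (apply Rdiv_lt_0_compat; lra).
destruct (proj1 (generator_eps x (A0 x)) (conj Dx eq_refl) _ He)
  as (d1 & Hd1 & H1).
destruct (proj1 (continuous_eps _ t)
  (sf_continuous _ strong_family_orbit (A0 x) t) (eps / 2) ltac:(lra))
  as (d2 & Hd2 & H2).
exists (Rmin 1 (Rmin d1 d2)); split; [repeat apply Rmin_pos; lra|].
intros s Hs0 Hs.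
assert (Hm1 := Rmin_l 1 (Rmin d1 d2)); assert (Hm2 := Rmin_r 1 (Rmin d1 d2)).
assert (Hm3 := Rmin_l d1 d2); assert (Hm4 := Rmin_r d1 d2).
assert (Hs' := Rabs_def2 _ _ Hs).
specialize (H2 s ltac:(lra)).
rewrite !orbit_family_pos in H2 by lra.
change (norm (minus (T s (A0 x)) (T t (A0 x))) < eps / 2) in H2.
assert (Hb : forall u h, 0 <= u <= t + 1 -> 0 < h < d1 ->
  norm (T u (minus (minus (T h x) x) (scal h (A0 x)))) <= eps / 2 * h).
{ intros u h Hu Hh; eapply Rle_trans; [now apply HMb|].
  apply Rle_trans with (M * (eps / (2 * M) * h)).
  - apply Rmult_le_compat_l; [lra|now apply H1].
  - right; field; lra. }
assert (El : forall u h, 0 <= u -> 0 < h ->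
  T u (minus (minus (T h x) x) (scal h (A0 x))) =
  minus (minus (T (u + h) x) (T u x)) (scal h (T u (A0 x)))).
{ intros u h Hu Hh.
  assert (Hlin := sg_linear T D0 A0 HT u Hu).
  rewrite !(linear_minus (T u)) by exact Hlin.
  rewrite <- (sg_add T D0 A0 HT) by lra; now rewrite (linear_scal_real (T u)). }
destruct (total_order_T s t) as [[Hlt| ->]|Hgt].
- assert (Ea : Rabs (s - t) = t - s) by (rewrite Rabs_left; lra).
  rewrite Ea in *.
  specialize (Hb s (t - s) ltac:(lra) ltac:(lra)).
  norm_as (plus (scal (t - s) (minus (T t (A0 x)) (T s (A0 x))))
    (opp (T s (minus (minus (T (t - s) x) x) (scal (t - s) (A0 x))))))
    by (rewrite El by lra; replace (s + (t - s)) with t by ring; module_eq).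
  norm_tri; norm_opp_eq; norm_scal_eq; rewrite Rabs_pos_eq by lra.
  replace (norm (minus (T t (A0 x)) (T s (A0 x)))) with
    (norm (minus (T s (A0 x)) (T t (A0 x)))); [nra|].
  rewrite <- (norm_opp (minus (T s (A0 x)) (T t (A0 x)))); f_equal; module_eq.
- norm_as (@zero Y) by module_eq; norm_zero_eq.
  apply Rmult_le_pos; [lra|apply Rabs_pos].
- assert (Ea : Rabs (s - t) = s - t) by (rewrite Rabs_pos_eq; lra).
  rewrite Ea in *.
  specialize (Hb t (s - t) ltac:(lra) ltac:(lra)).
  rewrite El in Hb by lra; replace (t + (s - t)) with s in Hb by ring.
  apply Rle_trans with (eps / 2 * (s - t)); [exact Hb|]; nra.
Qed.

(** [orbit_family r x] generally has a corner at 0; integrating its derivative, frozen at [A0 x] for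
    negative times, gives a C^1 extension of the orbit. *)
Lemma orbit_C1 (x : Y) : D0 x ->
  exists p : R -> Y,
    (forall r, is_derive p r (orbit_family r (A0 x))) /\
    forall r, 0 <= r -> p r = T r x.
Proof.
intros Dx; assert (HO := strong_family_orbit).
assert (Hex : forall u v, ex_RInt (fun s => orbit_family s (A0 x)) u v).
{ intros u v; apply ex_RInt_continuous; intros; now apply sf_continuous. }
exists (fun r => plus x (RInt (fun s => orbit_family s (A0 x)) 0 r)); split.
- intros t; refine (proj2 (is_derive_eps _ t _) _); intros eps Heps.
  assert (Hd : is_derive (fun t => RInt (fun s => orbit_family s (A0 x)) 0 t) t
    (orbit_family t (A0 x))).
  { refine (is_derive_RInt (fun s => orbit_family s (A0 x))
      (fun t => RInt (fun s => orbit_family s (A0 x)) 0 t) 0 t _ _);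
      [|now apply sf_continuous].
    exists (mkposreal 1 Rlt_0_1); intros y _; now apply RInt_correct. }
  destruct (proj1 (is_derive_eps _ _ _) Hd eps Heps) as (d & Hd0 & Hs).
  exists d; split; trivial; intros s Hst.
  norm_as (minus (minus (RInt (fun s => orbit_family s (A0 x)) 0 s)
      (RInt (fun s => orbit_family s (A0 x)) 0 t))
      (scal (s - t) (orbit_family t (A0 x)))) by module_eq.
  now apply Hs.
- intros r Hr.
  assert (Hw : forall s, 0 <= s <= r ->
    is_derive_within (fun s => 0 <= s <= r) (fun s => T s x) s
      (orbit_family s (A0 x))).
  { intros s Hs; rewrite orbit_family_pos by lra.
    apply (is_derive_within_loc (fun s => 0 <= s) (fun s => 0 <= s <= r)
      (fun s => T s x) (fun s => T s x)); trivial; try lra;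
      [|now apply is_derive_orbit].
    exists 1; split; [lra|]; intros u Hu _; split; [lra|easy]. }
  assert (HI : is_RInt (fun s => orbit_family s (A0 x)) 0 r
    (minus (T r x) (T 0 x))).
  { apply (is_RInt_derive_within (fun s => T s x) _ 0 r nil);
      [exact Hr| | |apply Hex].
    - intros s Hs; now apply (is_derive_within_continuous _ _ _ _ Hs (Hw s Hs)).
    - intros s Hs _; now apply Hw. }
  rewrite (is_RInt_unique _ _ _ _ HI), (sg_zero T D0 A0 HT); module_eq.
Qed.

End Semigroups.

(** * The inhomogeneous Cauchy problem and the Dyson-Phillips series *)

Section Derivatives.

Context {Y : CompleteNormedModule R_AbsRing}.

Lemma is_derive_linear (L : Y -> Y) (f : R -> Y) (t : R) (l : Y) :
  is_linear L -> is_derive f t l -> is_derive (fun s => L (f s)) t (L l).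
Proof.
intros HL Hf; refine (proj2 (is_derive_eps _ t _) _); intros eps Heps.
destruct (linear_norm _ HL) as (C & HC & HCb).
assert (He : 0 < eps / C) by now apply Rdiv_lt_0_compat.
destruct (proj1 (is_derive_eps _ _ _) Hf _ He) as (d & Hd & Hs).
exists d; split; trivial; intros s Hst.
norm_as (L (minus (minus (f s) (f t)) (scal (s - t) l)))
  by (rewrite !(linear_minus L), (linear_scal_real L) by exact HL; module_eq).
eapply Rle_trans; [apply HCb|].
apply Rle_trans with (C * (eps / C * Rabs (s - t)));
  [apply Rmult_le_compat_l; [lra|now apply Hs]|right; field; lra].
Qed.

Lemma is_derive_within_linear (L : Y -> Y) (D : R -> Prop) (f : R -> Y) (t : R)
    (l : Y) : D t ->
  is_linear L -> is_derive_within D f t l ->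
  is_derive_within D (fun s => L (f s)) t (L l).
Proof.
intros Dt HL Hf; refine (proj2 (is_derive_within_eps D _ t _ Dt) _).
intros eps Heps.
destruct (linear_norm _ HL) as (C & HC & HCb).
assert (He : 0 < eps / C) by now apply Rdiv_lt_0_compat.
destruct (proj1 (is_derive_within_eps D _ _ _ Dt) Hf _ He) as (d & Hd & Hs).
exists d; split; trivial; intros s Ds Hst.
norm_as (L (minus (minus (f s) (f t)) (scal (s - t) l)))
  by (rewrite !(linear_minus L), (linear_scal_real L) by exact HL; module_eq).
eapply Rle_trans; [apply HCb|].
apply Rle_trans with (C * (eps / C * Rabs (s - t)));
  [apply Rmult_le_compat_l; [lra|now apply Hs]|right; field; lra].
Qed.

Lemma continuous_linear (L : Y -> Y) (f : R -> Y) (t : R) :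
  is_linear L -> continuous f t -> continuous (fun s => L (f s)) t.
Proof.
intros HL Hf; exact (continuous_comp f L t Hf (linear_cont L (f t) HL)).
Qed.

Lemma continuous_on_linear (L : Y -> Y) (D : R -> Prop) (f : R -> Y) :
  is_linear L -> continuous_on D f -> continuous_on D (fun s => L (f s)).
Proof.
intros HL Hf t Dt.
exact (filterlim_comp _ _ _ f L _ _ _ (Hf t Dt) (linear_cont L (f t) HL)).
Qed.

Lemma C1_on_linear (L : Y -> Y) (D : R -> Prop) (f df : R -> Y) :
  is_linear L -> C1_on D f df ->
  C1_on D (fun s => L (f s)) (fun s => L (df s)).
Proof.
intros HL [Hf Hdf]; split; [|now apply continuous_on_linear].
intros t Dt; apply is_derive_within_linear; auto.
Qed.

Lemma is_derive_sum (f g : R -> Y) (t : R) (l m : Y) :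
  is_derive f t l -> is_derive g t m ->
  is_derive (fun s => plus (f s) (g s)) t (plus l m).
Proof. exact (is_derive_plus f g t l m). Qed.

Lemma is_derive_continuous (f : R -> Y) (t : R) (l : Y) :
  is_derive f t l -> continuous f t.
Proof. intros H; refine (ex_derive_continuous f t _); now exists l. Qed.

Lemma conv_ext (W : R -> Y -> Y) (k l : R -> Y) (r : R) : 0 <= r ->
  (forall y, 0 <= y <= r -> k y = l y) -> conv W k r = conv W l r.
Proof.
intros Hr E; apply RInt_ext; intros s Hs.
rewrite Rmin_left, Rmax_right in Hs by lra; rewrite E; [easy|lra].
Qed.

Lemma conv_plus (W : R -> Y -> Y) (k l : R -> Y) (r : R) :
  strong_family W -> (forall t, continuous k t) -> (forall t, continuous l t) ->
  conv W (fun y => plus (k y) (l y)) r = plus (conv W k r) (conv W l r).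
Proof.
intros HW Hk Hl; unfold conv.
rewrite <- (RInt_plus (fun s => W s (k (r - s))) (fun s => W s (l (r - s)))).
- apply RInt_ext; intros s _; exact (linear_plus _ (sf_linear W HW s) _ _).
- eexists; now apply is_RInt_conv.
- eexists; now apply is_RInt_conv.
Qed.

Lemma conv_scal (W : R -> Y -> Y) (k : R -> Y) (c r : R) :
  strong_family W -> (forall t, continuous k t) ->
  conv W (fun y => scal c (k y)) r = scal c (conv W k r).
Proof.
intros HW Hk; unfold conv.
etransitivity; [|apply (RInt_scal (fun s => W s (k (r - s))));
  eexists; now apply is_RInt_conv].
apply RInt_ext; intros s _; exact (linear_scal _ (sf_linear W HW s) _ _).
Qed.

Lemma conv_zero (W : R -> Y -> Y) (r : R) :
  strong_family W -> conv W (fun _ => zero) r = zero.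
Proof.
intros HW; unfold conv; apply is_RInt_unique.
apply (is_RInt_ext (fun _ => zero)).
- intros s _; symmetry; apply linear_zero, (sf_linear W HW).
- assert (E : scal (r - 0) (@zero Y) = zero) by module_eq.
  exact (eq_ind _ (is_RInt (fun _ => zero) 0 r) (is_RInt_const 0 r zero) _ E).
Qed.

End Derivatives.

Section Duhamel.

Context {Y : CompleteNormedModule R_AbsRing}.
Context (T : R -> Y -> Y) (D0 : Y -> Prop) (A0 : Y -> Y).
Context (HT : real_semigroup T D0 A0).

Let O := orbit_family T.
Let HO : strong_family O := strong_family_orbit T D0 A0 HT.

(* The convolution with the semigroup satisfies
   [T h (conv k r) = conv k (r + h) - RInt (T s (k (r + h - s))) 0 h], which
   computes the difference quotient defining the generator. *)
Lemma semigroup_conv (k : R -> Y) (r h : R) :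
  (forall t, continuous k t) -> 0 <= r -> 0 <= h ->
  T h (conv O k r) =
  minus (conv O k (r + h)) (RInt (fun s => O s (k (r + h - s))) 0 h).
Proof.
intros Hk Hr Hh.
assert (Hex : forall u v, ex_RInt (fun s => O s (k (r + h - s))) u v)
  by (intros u v; exact (ex_RInt_strong_family O (fun s => k (r + h - s)) u v HO
        (continuous_reflect k (r + h) Hk))).
transitivity (RInt (fun s => O s (k (r + h - s))) h (r + h)).
- transitivity (RInt (fun s => T h (O s (k (r - s)))) 0 r).
  { symmetry; apply RInt_linear; [now apply (sg_linear T D0 A0 HT)|].
    eexists; now apply is_RInt_conv. }
  transitivity (RInt (fun s => O (s + h) (k (r + h - (s + h)))) 0 r).
  + apply RInt_ext; intros s Hs; rewrite Rmin_left, Rmax_right in Hs by lra.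
    unfold O; rewrite !orbit_family_pos by lra.
    replace (r + h - (s + h)) with (r - s) by ring.
    rewrite (Rplus_comm s h); symmetry; apply (sg_add T D0 A0 HT); lra.
  + apply is_RInt_unique, (is_RInt_shift (fun s => O s (k (r + h - s)))).
    rewrite Rplus_0_l; now apply RInt_correct.
- unfold conv at 1.
  rewrite <- (RInt_Chasles (fun s => O s (k (r + h - s))) 0 h (r + h)) by apply Hex.
  module_eq.
Qed.

(** On [[0, h]] the integrand is uniformly close to [k r]. This is where the forcing term enters the
    generator of the convolution. *)
Lemma RInt_near_zero (k : R -> Y) (r eps : R) :
  (forall t, continuous k t) -> 0 < eps ->
  exists delta, 0 < delta /\ forall h, 0 < h < delta ->
    norm (minus (RInt (fun s => O s (k (r + h - s))) 0 h) (scal h (k r)))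
    <= eps * h.
Proof.
intros Hk Heps.
destruct (semigroup_bounded T D0 A0 HT 1) as (M & HM & HMb).
assert (He : 0 < eps / (2 * M)) by (apply Rdiv_lt_0_compat; lra).
destruct (proj1 (continuous_eps _ _) (Hk r) _ He) as (d1 & Hd1 & H1).
destruct (sg_continuous_zero T D0 A0 HT (k r) (eps / 2) ltac:(lra))
  as (d2 & Hd2 & H2).
exists (Rmin 1 (Rmin d1 d2)); split; [repeat apply Rmin_pos; lra|].
intros h Hh.
assert (Hm1 := Rmin_l 1 (Rmin d1 d2)); assert (Hm2 := Rmin_r 1 (Rmin d1 d2)).
assert (Hm3 := Rmin_l d1 d2); assert (Hm4 := Rmin_r d1 d2).
replace (eps * h) with ((h - 0) * eps) by ring.
apply (norm_RInt_le_const (fun s => minus (O s (k (r + h - s))) (k r)) 0 h);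
  [lra| |].
- intros s Hs; unfold O; rewrite orbit_family_pos by lra.
  norm_as (plus (T s (minus (k (r + h - s)) (k r))) (minus (T s (k r)) (k r)))
    by (rewrite (linear_minus (T s)) by (apply (sg_linear T D0 A0 HT); lra);
      module_eq).
  norm_tri.
  assert (N1 : norm (T s (minus (k (r + h - s)) (k r))) <= eps / 2).
  { eapply Rle_trans; [apply HMb; lra|].
    apply Rle_trans with (M * (eps / (2 * M))); [|right; field; lra].
    apply Rmult_le_compat_l; [lra|]; apply Rlt_le, H1.
    apply Rabs_def1; lra. }
  specialize (H2 s ltac:(lra)); lra.
- refine (is_RInt_minus _ _ _ _ _ _ _ _).
  + apply RInt_correct.
    exact (ex_RInt_strong_family O (fun s => k (r + h - s)) 0 h HO
      (continuous_reflect k (r + h) Hk)).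
  + assert (H := is_RInt_const 0 h (k r)); now rewrite Rminus_0_r in H.
Qed.

(** With [w] already known to be differentiable, [T h (w r) - w r = (w (r + h) - w r) - h k(r) +
    o(h)], so the quotient that defines the generator converges to [dw r - k r]. *)
Lemma inhomogeneous_cauchy (x : Y) (k dk : R -> Y) : D0 x ->
  (forall t, is_derive k t (dk t)) -> (forall t, continuous dk t) ->
  exists w dw : R -> Y,
    (forall r, is_derive w r (dw r)) /\ (forall r, continuous dw r) /\
    forall r, 0 <= r -> w r = plus (T r x) (conv O k r) /\
      D0 (w r) /\ dw r = plus (A0 (w r)) (k r).
Proof.
intros Dx Hk Hdk.
assert (Hkc : forall t, continuous k t)
  by (intros t; exact (is_derive_continuous k t _ (Hk t))).
destruct (orbit_C1 T D0 A0 HT x Dx) as (p & Hp & Ep).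
set (w := fun r => plus (p r) (conv O k r)).
set (dw := fun r => plus (O r (A0 x)) (plus (O r (k 0)) (conv O dk r))).
assert (Hw : forall r, is_derive w r (dw r)).
{ intros r; apply is_derive_sum; [apply Hp|now apply is_derive_conv]. }
exists w, dw; split; [exact Hw|split].
- intros r; apply (continuous_plus (fun r => O r (A0 x)));
    [now apply sf_continuous|].
  apply (continuous_plus (fun r => O r (k 0)));
    [now apply sf_continuous|now apply continuous_conv].
- intros r Hr; split; [unfold w; now rewrite Ep|].
  assert (Hg : D0 (w r) /\ A0 (w r) = minus (dw r) (k r)).
  { apply (generator_eps T D0 A0 HT); intros eps Heps.
    destruct (proj1 (is_derive_eps _ _ _) (Hw r) (eps / 2) ltac:(lra))
      as (d1 & Hd1 & H1).
    destruct (RInt_near_zero k r (eps / 2) Hkc ltac:(lra)) as (d2 & Hd2 & H2).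
    exists (Rmin d1 d2); split; [now apply Rmin_pos|]; intros h Hh.
    assert (Hm3 := Rmin_l d1 d2); assert (Hm4 := Rmin_r d1 d2).
    specialize (H1 (r + h)).
    replace (r + h - r) with h in H1 by ring.
    rewrite Rabs_pos_eq in H1 by lra.
    specialize (H1 ltac:(lra)); specialize (H2 h ltac:(lra)).
    assert (Eh : T h (w r) =
      minus (w (r + h)) (RInt (fun s => O s (k (r + h - s))) 0 h)).
    { unfold w; rewrite !Ep by lra.
      assert (Hl := sg_linear T D0 A0 HT h ltac:(lra)).
      transitivity (plus (T h (T r x)) (T h (conv O k r)));
        [exact (linear_plus _ Hl _ _)|].
      rewrite semigroup_conv, <- (sg_add T D0 A0 HT), (Rplus_comm h r)
        by (trivial; lra).
      module_eq. }
    rewrite Eh.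
    norm_as (plus (minus (minus (w (r + h)) (w r)) (scal h (dw r)))
      (opp (minus (RInt (fun s => O s (k (r + h - s))) 0 h) (scal h (k r)))))
      by module_eq.
    norm_tri; norm_opp_eq.
    change (norm (minus (minus (w (r + h)) (w r)) (scal h (dw r)))
      <= eps / 2 * h) in H1; lra. }
  split; [apply Hg|].
  destruct Hg as [_ ->]; module_eq.
Qed.

Definition mild (f : R -> Y) (x : Y) (r : R) : Y :=
  plus (T r x) (RInt (fun s => T s (f (r - s))) 0 r).

(** The forcing is extended to the line as a C^1 function; up to time [b] the mild formula sees only
    its values on [[0, b]]. *)
Lemma mild_classical (x : Y) (f df : R -> Y) (b : R) :
  0 <= b -> D0 x -> C1_on (fun t => 0 <= t <= b) f df ->
  C1_on (fun t => 0 <= t <= b) (mild f x)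
    (fun t => plus (A0 (mild f x t)) (f t)) /\
  (forall t, 0 <= t <= b -> D0 (mild f x t)) /\ mild f x 0 = x.
Proof.
intros Hb Dx Hf.
destruct (C1_extension 0 b f df Hb Hf) as (F & dF & HF & HdF & EF).
destruct (inhomogeneous_cauchy x F dF Dx HF HdF) as (w & dw & Hw & Hdw & E).
assert (Ew : forall t, 0 <= t <= b -> w t = mild f x t).
{ intros t Ht; rewrite (proj1 (E t (proj1 Ht))); unfold mild, conv; f_equal.
  apply RInt_ext; intros s Hs; rewrite Rmin_left, Rmax_right in Hs by lra.
  unfold O; rewrite orbit_family_pos by lra.
  now rewrite (proj1 (EF (t - s) ltac:(lra))). }
split; [|split].
- apply (C1_on_ext (fun _ => True) _ w dw).
  + intros t Ht; split; [easy|split; [now apply Ew|]].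
    rewrite <- Ew by trivial; rewrite <- (proj1 (EF t Ht)).
    now apply E.
  + split; [|now apply continuous_on_of_continuous].
    intros t _; now apply is_derive_within_of_is_derive.
- intros t Ht; rewrite <- Ew by trivial; now apply E.
- unfold mild; rewrite RInt_point, (sg_zero T D0 A0 HT); module_eq.
Qed.

(** * Dyson-Phillips iterates *)

Context (A1 : Y -> Y) (HA1 : is_linear A1).

(** After the shift by [n tau] the delay has left the recursion. [Rmax r 0] extends the terms to
    negative times, by zero for [n >= 1]; [n = 0] is extended by the identity. *)
Fixpoint dyson (n : nat) (r : R) (x : Y) : Y :=
  match n with
  | 0%nat => O r x
  | S m => conv O (fun y => A1 (dyson m y x)) (Rmax r 0)
  end.

Lemma strong_family_dyson (n : nat) : strong_family (dyson n).
Proof.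
induction n as [|n IH]; [exact HO|].
assert (IHA := strong_family_comp (dyson n) A1 IH HA1).
assert (Hc : forall x t, continuous (fun y => A1 (dyson n y x)) t)
  by (intros x t; exact (sf_continuous _ IHA x t)).
assert (Hb : forall a, exists M, 0 < M /\
  forall r x, r <= a -> norm (dyson (S n) r x) <= M * norm x).
{ intros a; destruct (sf_bounded O HO (Rmax a 0)) as (M & HM & HMb).
  destruct (sf_bounded _ IHA (Rmax a 0)) as (C & HC & HCb).
  assert (Ha0 := Rmax_r a 0).
  (* The length of the interval of integration is at most [Rmax a 0]; adding 1 keeps the constant
     positive for [a <= 0]. *)
  exists ((Rmax a 0 + 1) * (M * C)); split; [repeat apply Rmult_lt_0_compat; lra|]; intros r x Hr; cbn [dyson].
  assert (Hr0 := Rmax_r r 0).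
  assert (Hra : Rmax r 0 <= Rmax a 0) by now apply Rle_max_compat_r.
  assert (Hx := norm_ge_0 x).
  apply Rle_trans with ((Rmax r 0 - 0) * (M * (C * norm x))).
  - apply (norm_RInt_le_const
      (fun s => O s (A1 (dyson n (Rmax r 0 - s) x))) 0 (Rmax r 0)); trivial.
    + intros s Hs; eapply Rle_trans; [apply HMb; lra|].
      apply Rmult_le_compat_l; [lra|]; apply HCb; lra.
    + exact (is_RInt_conv O (fun y => A1 (dyson n y x)) (Rmax r 0) HO (Hc x)).
  - replace ((Rmax a 0 + 1) * (M * C) * norm x)
      with ((Rmax a 0 + 1) * (M * (C * norm x))) by ring.
    apply Rmult_le_compat_r; [repeat apply Rmult_le_pos; lra|lra]. }
split.
- intros r; split.
  + intros x y; cbn [dyson].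
    etransitivity; [|apply (conv_plus O (fun s => A1 (dyson n s x))
      (fun s => A1 (dyson n s y))); trivial].
    f_equal; apply functional_extensionality; intros s.
    exact (linear_plus _ (sf_linear _ IHA s) x y).
  + intros c x; cbn [dyson].
    etransitivity; [|apply (conv_scal O (fun y => A1 (dyson n y x)) c (Rmax r 0));
      trivial].
    f_equal; apply functional_extensionality; intros s.
    exact (linear_scal _ (sf_linear _ IHA s) c x).
  + destruct (Hb r) as (M & HM & HMb); exists M; split; trivial.
    intros x; apply HMb; lra.
- exact Hb.
- intros x r; cbn [dyson].
  apply (continuous_comp_real (conv O (fun y => A1 (dyson n y x))));
    [apply continuous_max_r|now apply continuous_conv].
Qed.

Lemma dyson_nonpos (n : nat) (r : R) (x : Y) : r <= 0 -> dyson (S n) r x = zero.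
Proof. intros Hr; cbn [dyson]; rewrite Rmax_right by lra; apply RInt_point. Qed.

Definition dyson_pred (n : nat) (r : R) (x : Y) : Y :=
  match n with
  | 0%nat => zero
  | S m => dyson m r x
  end.

(* [dyson (S n)] is [O * (A1 dyson n)] while its derivative needs
   [dyson n * (A1 O)]: differentiating under the convolution lets the second
   form propagate by induction, without an exchange of integrals. *)
Lemma dyson_C1 (n : nat) (x : Y) : D0 x ->
  exists p dp : R -> Y,
    (forall r, is_derive p r (dp r)) /\ (forall r, continuous dp r) /\
    forall r, 0 <= r -> p r = dyson n r x /\
      dp r = plus (dyson n r (A0 x)) (dyson_pred n r (A1 x)).
Proof.
intros Dx; induction n as [|n (p & dp & Hp & Hdp & E)].
- destruct (orbit_C1 T D0 A0 HT x Dx) as (p & Hp & Ep).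
  exists p, (fun r => O r (A0 x)); split; [exact Hp|split].
  + intros r; now apply sf_continuous.
  + intros r Hr; cbn; split; [|module_eq].
    unfold O; rewrite orbit_family_pos by lra; now apply Ep.
- set (k := fun y => A1 (p y)); set (dk := fun y => A1 (dp y)).
  assert (Hk : forall t, is_derive k t (dk t))
    by (intros t; exact (is_derive_linear A1 p t (dp t) HA1 (Hp t))).
  assert (Hdk : forall t, continuous dk t)
    by (intros t; exact (continuous_linear A1 dp t HA1 (Hdp t))).
  exists (conv O k), (fun r => plus (O r (k 0)) (conv O dk r)); split; [|split].
  + intros r; now apply is_derive_conv.
  + intros r; apply (continuous_plus (fun r => O r (k 0)));
      [now apply sf_continuous|now apply continuous_conv].
  + intros r Hr; split.
    { cbn [dyson]; rewrite Rmax_left by lra; apply conv_ext; trivial.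
      intros y Hy; unfold k; now rewrite (proj1 (E y (proj1 Hy))). }
    assert (Hc : forall m z t, continuous (fun y => A1 (dyson m y z)) t).
    { intros m z t; apply continuous_linear; trivial.
      apply sf_continuous, strong_family_dyson. }
    (* The boundary term carries the start of the induction: for [n = 0] it is the whole right side,
       the predecessor being zero. For larger [n] it vanishes, since the iterate is zero at time 0,
       and the convolution is the recursion itself. *)
    assert (Epred : plus (O r (k 0)) (conv O (fun y => A1 (dyson_pred n y (A1 x))) r)
      = dyson n r (A1 x)).
    { unfold k; rewrite (proj1 (E 0 (Rle_refl 0))); destruct n as [|n].
      - cbn [dyson dyson_pred].
        replace (O 0 x) with x by (unfold O;
          rewrite orbit_family_pos, (sg_zero T D0 A0 HT); trivial; lra).
        rewrite (linear_zero A1 HA1), (conv_zero O r HO); module_eq.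
      - rewrite dyson_nonpos by lra.
        rewrite (linear_zero A1 HA1), (linear_zero (O r) (sf_linear O HO r)).
        cbn [dyson dyson_pred]; rewrite (Rmax_left r 0) by lra; module_eq. }
    cbn [dyson_pred]; rewrite <- Epred.
    replace (conv O dk r) with (plus (conv O (fun y => A1 (dyson n y (A0 x))) r)
      (conv O (fun y => A1 (dyson_pred n y (A1 x))) r)).
    * cbn [dyson]; rewrite (Rmax_left r 0) by lra; module_eq.
    * rewrite <- conv_plus; trivial.
      -- apply conv_ext; trivial; intros y Hy; unfold dk.
         rewrite (proj2 (E y (proj1 Hy))); symmetry; apply (linear_plus _ HA1).
      -- intros t; destruct n as [|n]; cbn [dyson_pred]; [|apply Hc].
         apply continuous_const.
Qed.

End Duhamel.

(** * The fundamental solution and the variation of constants formula *)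

Section Auxiliary.

Context {Y : CompleteNormedModule R_AbsRing}.

Lemma continuous_clamp_left (f : R -> Y) (a t : R) :
  continuous_on (fun s => a <= s) f -> continuous (fun s => f (Rmax s a)) t.
Proof.
intros Hf; refine (proj2 (continuous_eps (fun s => f (Rmax s a)) t) _).
intros eps Heps.
destruct (proj1 (continuous_on_eps _ _) Hf _ (Rmax_r t a) eps Heps)
  as (d & Hd & Hs).
exists d; split; trivial; intros s Hst; apply Hs; [apply Rmax_r|].
eapply Rle_lt_trans; [|exact Hst].
unfold Rmax; repeat destruct Rle_dec; unfold Rabs;
  repeat destruct Rcase_abs; lra.
Qed.

Lemma is_derive_shift_loc (f p : R -> Y) (t c : R) (l : Y) :
  (exists d, 0 < d /\ forall s, Rabs (s - t) < d -> f s = p (s - c)) ->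
  is_derive p (t - c) l -> is_derive f t l.
Proof.
intros (d0 & Hd0 & E) Hp; apply is_derive_eps; intros eps Heps.
destruct (proj1 (is_derive_eps _ _ _) Hp eps Heps) as (d & Hd & Hs).
exists (Rmin d d0); split; [now apply Rmin_pos|]; intros s Hst.
assert (Hm1 := Rmin_l d d0); assert (Hm2 := Rmin_r d d0).
rewrite (E s), (E t) by (trivial; rewrite ?Rminus_diag, ?Rabs_R0; lra).
replace (s - t) with (s - c - (t - c)) by ring; apply Hs.
replace (s - c - (t - c)) with (s - t) by ring; lra.
Qed.

(** The jump of [S] at time 0 cuts off the integrand [S(t - tau - s) A1 u(s)] at [s = t - tau];
    elsewhere it is continuous. *)
Lemma ex_RInt_cut (k : R -> Y) (c a b : R) :
  (forall t, continuous k t) ->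
  ex_RInt (fun s => if Rle_dec s c then k s else zero) a b.
Proof.
intros Hk.
assert (Hz : forall u v, ex_RInt (fun _ => @zero Y) u v)
  by (intros u v; eexists; apply is_RInt_const).
assert (H : forall u v, u <= v ->
  ex_RInt (fun s => if Rle_dec s c then k s else zero) u v).
{ intros u v Huv.
  assert (Hl : forall w, u <= w <= c ->
    ex_RInt (fun s => if Rle_dec s c then k s else zero) u w).
  { intros w Hw; apply (ex_RInt_ext k); [|apply ex_RInt_continuous; auto].
    intros s Hs; rewrite Rmin_left, Rmax_right in Hs by lra.
    destruct (Rle_dec s c); [easy|lra]. }
  assert (Hr : forall w, c <= w <= v ->
    ex_RInt (fun s => if Rle_dec s c then k s else zero) w v).
  { intros w Hw; apply (ex_RInt_ext (fun _ => zero)); [|apply Hz].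
    intros s Hs; rewrite Rmin_left, Rmax_right in Hs by lra.
    destruct (Rle_dec s c); [lra|easy]. }
  destruct (Rle_dec v c); [apply Hl; lra|].
  destruct (Rle_dec c u); [apply Hr; lra|].
  apply (ex_RInt_Chasles _ u c v); [apply Hl|apply Hr]; lra. }
destruct (Rle_dec a b); [now apply H|].
apply ex_RInt_swap, H; lra.
Qed.

(** Product rule for strongly continuous operators: the remainder of [v] is absorbed by the local
    bound, and increments of [W] act on the fixed vectors [v s] and [dv]. Differentiability of the
    orbit is thus asked for at the single vector [v s]. *)
Lemma is_derive_within_app (W : R -> Y -> Y) (D : R -> Prop) (v : R -> Y)
    (t s : R) (l dv : Y) :
  strong_family W -> D s ->
  is_derive (fun r => W r (v s)) (t - s) l -> is_derive_within D v s dv ->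
  is_derive_within D (fun u => W (t - u) (v u)) s (minus (W (t - s) dv) l).
Proof.
intros HW Ds Hl Hv.
refine (proj2 (is_derive_within_eps D _ s _ Ds) _); intros eps Heps.
destruct (sf_bounded W HW (t - s + 1)) as (M & HM & HMb).
assert (He : 0 < eps / (4 * M)) by (apply Rdiv_lt_0_compat; lra).
destruct (proj1 (is_derive_within_eps D _ _ _ Ds) Hv _ He) as (d1 & Hd1 & H1).
destruct (proj1 (is_derive_eps _ _ _) Hl (eps / 4) ltac:(lra))
  as (d2 & Hd2 & H2).
destruct (proj1 (continuous_eps _ _) (sf_continuous W HW dv (t - s)) (eps / 4)
  ltac:(lra)) as (d3 & Hd3 & H3).
exists (Rmin (Rmin d1 d2) (Rmin 1 d3)); split; [repeat apply Rmin_pos; lra|].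
intros u Du Hu.
assert (Hm : Rabs (u - s) < d1 /\ Rabs (u - s) < d2 /\ Rabs (u - s) < 1 /\
  Rabs (u - s) < d3).
{ assert (Hm1 := Rmin_l (Rmin d1 d2) (Rmin 1 d3)).
  assert (Hm2 := Rmin_r (Rmin d1 d2) (Rmin 1 d3)).
  assert (Hm3 := Rmin_l d1 d2); assert (Hm4 := Rmin_r d1 d2).
  assert (Hm5 := Rmin_l 1 d3); assert (Hm6 := Rmin_r 1 d3).
  repeat split; lra. }
destruct Hm as (Hm1 & Hm2 & Hm3 & Hm4); apply Rabs_def2 in Hm3 as Hm5.
assert (Er : t - u - (t - s) = - (u - s)) by ring.
assert (Ea : Rabs (t - u - (t - s)) = Rabs (u - s))
  by (rewrite Er; apply Rabs_Ropp).
specialize (H1 u Du Hm1).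
specialize (H2 (t - u) ltac:(rewrite Ea; exact Hm2)).
specialize (H3 (t - u) ltac:(rewrite Ea; exact Hm4)).
rewrite Ea, Er in H2.
change (norm (minus (W (t - u) dv) (W (t - s) dv)) < eps / 4) in H3.
change (norm (minus (minus (W (t - u) (v s)) (W (t - s) (v s)))
  (scal (- (u - s)) l)) <= eps / 4 * Rabs (u - s)) in H2.
change (norm (minus (minus (v u) (v s)) (scal (u - s) dv))
  <= eps / (4 * M) * Rabs (u - s)) in H1.
assert (N1 := HMb (t - u) (minus (minus (v u) (v s)) (scal (u - s) dv))
  ltac:(lra)).
assert (N1' : M * norm (minus (minus (v u) (v s)) (scal (u - s) dv)) <=
  eps / 4 * Rabs (u - s)).
{ apply Rle_trans with (M * (eps / (4 * M) * Rabs (u - s)));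
    [apply Rmult_le_compat_l; lra|right; field; lra]. }
norm_as (plus (W (t - u) (minus (minus (v u) (v s)) (scal (u - s) dv)))
  (plus (scal (u - s) (minus (W (t - u) dv) (W (t - s) dv)))
    (minus (minus (W (t - u) (v s)) (W (t - s) (v s)))
      (scal (- (u - s)) l))))
  by (rewrite !(linear_minus (W (t - u))), (linear_scal_real (W (t - u)))
        by apply (sf_linear W HW); module_eq).
norm_tri.
apply Rle_trans with (eps / 4 * Rabs (u - s) +
  (norm (scal (u - s) (minus (W (t - u) dv) (W (t - s) dv))) +
   norm (minus (minus (W (t - u) (v s)) (W (t - s) (v s)))
      (scal (- (u - s)) l)))).
- apply Rplus_le_compat; [lra|].
  exact (norm_triangle _ _).
- norm_scal_eq; assert (Hp := Rabs_pos (u - s)); nra.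
Qed.

End Auxiliary.

Section Fundamental.

Context {Y : CompleteNormedModule R_AbsRing}.
Context (T : R -> Y -> Y) (D0 : Y -> Prop) (A0 : Y -> Y).
Context (HT : real_semigroup T D0 A0).
Context (A1 : Y -> Y) (HA1 : is_linear A1).
Context (tau : R) (Htau : 0 < tau).

Let V := dyson T A1.
Let HV (n : nat) : strong_family (V n) := strong_family_dyson T D0 A0 HT A1 HA1 n.

Definition cut_dyson (n : nat) (r : R) (x : Y) : Y :=
  if Rle_dec (INR n * tau) r then V n (r - INR n * tau) x else zero.

Definition fund_sum (N : nat) (r : R) (x : Y) : Y :=
  sum_n (fun n => cut_dyson n r x) N.

(** Agrees with [fund_sum] for [r >= 0], but continues as the identity at negative times in place of
    dropping to zero, and is therefore strongly continuous on the whole line. *)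
Fixpoint fund_family (N : nat) (r : R) (x : Y) : Y :=
  match N with
  | 0%nat => V 0 r x
  | S M => plus (fund_family M r x) (V (S M) (r - INR (S M) * tau) x)
  end.

Lemma strong_family_fund (N : nat) : strong_family (fund_family N).
Proof.
induction N as [|N IH]; [exact (HV 0)|].
apply (strong_family_plus (fund_family N)
  (fun r x => V (S N) (r - INR (S N) * tau) x)); trivial.
apply strong_family_shift; [|apply HV].
apply Rmult_le_pos; [apply pos_INR|lra].
Qed.

Lemma fund_sum_S (N : nat) (r : R) (x : Y) :
  fund_sum (S N) r x = plus (fund_sum N r x) (cut_dyson (S N) r x).
Proof. unfold fund_sum; now rewrite sum_Sn. Qed.

Lemma fund_sum_O (r : R) (x : Y) : fund_sum 0 r x = cut_dyson 0 r x.
Proof. unfold fund_sum; now rewrite sum_O. Qed.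

Lemma cut_dyson_neg (n : nat) (r : R) (x : Y) :
  r < INR n * tau -> cut_dyson n r x = zero.
Proof. intros H; unfold cut_dyson; destruct Rle_dec; [lra|easy]. Qed.

Lemma fund_sum_neg (N : nat) (r : R) (x : Y) : r < 0 -> fund_sum N r x = zero.
Proof.
intros Hr; induction N as [|N IH].
- rewrite fund_sum_O; apply cut_dyson_neg; cbn; lra.
- rewrite fund_sum_S, IH, cut_dyson_neg; [module_eq|].
  assert (0 <= INR (S N) * tau) by (apply Rmult_le_pos; [apply pos_INR|lra]); lra.
Qed.

Lemma fund_sum_family (N : nat) (r : R) (x : Y) :
  0 <= r -> fund_sum N r x = fund_family N r x.
Proof.
intros Hr; induction N as [|N IH].
- rewrite fund_sum_O; unfold cut_dyson; cbn [INR fund_family].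
  destruct Rle_dec; [f_equal; ring|lra].
- rewrite fund_sum_S, IH; cbn [fund_family]; f_equal.
  unfold cut_dyson; destruct Rle_dec; [easy|].
  symmetry; apply dyson_nonpos; lra.
Qed.

Lemma fund_family_nonpos (N : nat) (r : R) (x : Y) :
  r <= 0 -> fund_family N r x = x.
Proof.
intros Hr; induction N as [|N IH]; cbn [fund_family].
- unfold V; cbn [dyson]; unfold orbit_family; rewrite Rmax_right by lra.
  apply (sg_zero T D0 A0 HT).
- assert (0 <= INR (S N) * tau) by (apply Rmult_le_pos; [apply pos_INR|lra]).
  rewrite IH; unfold V; rewrite dyson_nonpos by lra; module_eq.
Qed.

Definition cut_pred (n : nat) (r : R) (y : Y) : Y :=
  match n with
  | 0%nat => zero
  | S m => cut_dyson m (r - tau) y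
  end.

(** Off its starting time the term is locally zero or locally a shift of the C^1 function of
    [dyson_C1]. The predecessor, started one delay earlier and read one delay earlier, has the same
    shifted argument. *)
Lemma is_derive_cut_dyson (n : nat) (r : R) (x : Y) :
  D0 x -> r <> INR n * tau ->
  is_derive (fun s => cut_dyson n s x) r
    (plus (cut_dyson n r (A0 x)) (cut_pred n r (A1 x))).
Proof.
intros Dx Hr; destruct (Rlt_dec r (INR n * tau)) as [Hlt|Hge].
- assert (E : plus (cut_dyson n r (A0 x)) (cut_pred n r (A1 x)) = zero).
  { rewrite (cut_dyson_neg n) by trivial.
    replace (cut_pred n r (A1 x)) with (@zero Y); [module_eq|].
    destruct n as [|m]; [easy|]; cbn [cut_pred]; symmetry.
    apply cut_dyson_neg; rewrite S_INR in Hlt; lra. }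
  rewrite E.
  apply (is_derive_shift_loc _ (fun _ => zero) r 0); [|exact (is_derive_const zero _)].
  exists (INR n * tau - r); split; [lra|]; intros s Hs; apply Rabs_def2 in Hs.
  apply cut_dyson_neg; lra.
- destruct (dyson_C1 T D0 A0 HT A1 HA1 n x Dx) as (p & dp & Hp & _ & E).
  replace (plus (cut_dyson n r (A0 x)) (cut_pred n r (A1 x)))
    with (dp (r - INR n * tau)).
  + apply (is_derive_shift_loc _ p r (INR n * tau)); [|apply Hp].
    exists (r - INR n * tau); split; [lra|]; intros s Hs; apply Rabs_def2 in Hs.
    unfold cut_dyson; destruct Rle_dec; [|lra].
    symmetry; apply E; lra.
  + rewrite (proj2 (E (r - INR n * tau) ltac:(lra))); f_equal.
    * unfold cut_dyson; destruct Rle_dec; [easy|lra].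
    * destruct n as [|m]; [easy|]; cbn [cut_pred dyson_pred].
      rewrite S_INR in *; unfold cut_dyson; destruct Rle_dec; [|lra].
      unfold V; f_equal; ring.
Qed.

(** Reindexing leaves over the last term of the sum at [r - tau], which has not started before
    [r = (N + 1) tau]. *)
Lemma sum_cut_pred (N : nat) (r : R) (y : Y) : r < INR (S N) * tau ->
  sum_n (fun n => cut_pred n r y) N = fund_sum N (r - tau) y.
Proof.
assert (H : forall M, sum_n (fun n => cut_pred n r y) (S M) =
  fund_sum M (r - tau) y).
{ induction M as [|M IH].
  - rewrite sum_Sn, sum_O, fund_sum_O; cbn [cut_pred]; module_eq.
  - now rewrite sum_Sn, IH, fund_sum_S. }
intros Hr; destruct N as [|N].
- rewrite sum_O, fund_sum_O; cbn [cut_pred]; symmetry; apply cut_dyson_neg.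
  cbn in *; lra.
- rewrite H, fund_sum_S, cut_dyson_neg; [module_eq|].
  rewrite (S_INR (S N)) in Hr; lra.
Qed.

Lemma is_derive_fund_sum (N : nat) (r : R) (x : Y) :
  D0 x -> (forall n, (n <= N)%nat -> r <> INR n * tau) -> r < INR (S N) * tau ->
  is_derive (fun s => fund_sum N s x) r
    (plus (fund_sum N r (A0 x)) (fund_sum N (r - tau) (A1 x))).
Proof.
(* The upper bound on [r] is spent on the reindexing at once, as it does not descend from [N + 1] to
   [N] in the induction. *)
intros Dx Hr HN; rewrite <- sum_cut_pred by trivial; clear HN.
induction N as [|N IH].
- rewrite fund_sum_O, sum_O.
  apply (is_derive_shift_loc _ (fun s => cut_dyson 0 s x) r 0).
  + exists 1; split; [lra|]; intros s _; rewrite Rminus_0_r; apply fund_sum_O.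
  + rewrite Rminus_0_r; apply is_derive_cut_dyson; auto.
- rewrite sum_Sn, fund_sum_S.
  apply (is_derive_shift_loc _
    (fun s => plus (fund_sum N s x) (cut_dyson (S N) s x)) r 0).
  + exists 1; split; [lra|]; intros s _; rewrite Rminus_0_r; apply fund_sum_S.
  + rewrite Rminus_0_r.
    replace (plus (plus (fund_sum N r (A0 x)) (cut_dyson (S N) r (A0 x)))
      (plus (sum_n (fun n => cut_pred n r (A1 x)) N) (cut_pred (S N) r (A1 x))))
      with (plus (plus (fund_sum N r (A0 x)) (sum_n (fun n => cut_pred n r (A1 x)) N))
        (plus (cut_dyson (S N) r (A0 x)) (cut_pred (S N) r (A1 x)))) by module_eq.
    apply is_derive_sum; [apply IH; auto|apply is_derive_cut_dyson; auto].
Qed.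

(** * Variation of constants *)

Definition jump_times (N : nat) (t : R) : list R :=
  map (fun n => t - INR n * tau) (seq 0 (S N)).

(** Continuous replacement for [S(t - s) v(s)]: for [s >= t] the operator is the identity and the
    vector is frozen, so the value is [v t]. *)
Definition duhamel (N : nat) (v : R -> Y) (t s : R) : Y :=
  fund_family N (t - s) (v (Rmin s t)).

Lemma continuous_on_duhamel (N : nat) (v : R -> Y) (a b t : R) :
  a <= b -> a <= t -> continuous_on (fun s => a <= s <= b) v ->
  continuous_on (fun s => a <= s <= b) (duhamel N v t).
Proof.
intros Hab Hat Hv.
set (k := fun s => v (Rmax (Rmin (Rmin s t) b) a)).
assert (Hk : forall s, continuous k s).
{ intros s; apply (continuous_comp_real (fun s => v (Rmax (Rmin s b) a))
    (fun s => Rmin s t)); [apply continuous_min_r|now apply continuous_clamp]. }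
intros s Hs.
apply (continuous_on_loc (fun s => a <= s <= b) _
  (fun s => fund_family N (t - s) (k s)) (duhamel N v t)).
- unfold duhamel, k; do 2 f_equal; unfold Rmax, Rmin;
    repeat destruct Rle_dec; lra.
- exists 1; split; [lra|]; intros u Hu _; split; trivial.
  unfold duhamel, k; do 2 f_equal; unfold Rmax, Rmin;
    repeat destruct Rle_dec; lra.
- apply (continuous_on_of_continuous (fun s => a <= s <= b)
    (fun s => fund_family N (t - s) (k s))); trivial.
  intros u _; apply strong_family_app;
    [apply strong_family_fund|apply continuous_sub_l|apply Hk].
Qed.

(** For [s < t] this is the product rule, with [A0 (v s)] collected under the same operator as
    [dv s]. For [s > t] the function is constant and both sums vanish. The remaining case [s = t] is
    a jump time. *)
Lemma is_derive_within_duhamel (N : nat) (v dv : R -> Y) (a b t s : R) :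
  a <= s <= b -> t - a < INR (S N) * tau ->
  is_derive_within (fun s => a <= s <= b) v s (dv s) -> D0 (v s) ->
  ~ In s (jump_times N t) ->
  is_derive_within (fun s => a <= s <= b) (duhamel N v t) s
    (minus (fund_sum N (t - s) (minus (dv s) (A0 (v s))))
      (fund_sum N (t - tau - s) (A1 (v s)))).
Proof.
intros Hs HN Hv Dv Hj.
assert (Hj' : forall n, (n <= N)%nat -> t - s <> INR n * tau).
{ intros n Hn E; apply Hj; unfold jump_times.
  apply in_map_iff; exists n; split; [lra|apply in_seq; lia]. }
assert (Hst : s <> t).
{ intros E; apply (Hj' 0%nat); [lia|cbn; lra]. }
destruct (Rlt_dec s t) as [Hlt|Hge].
- apply (is_derive_within_loc (fun s => a <= s <= b) (fun s => a <= s <= b)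
    (fun s => fund_family N (t - s) (v s))); trivial.
  + unfold duhamel; now rewrite Rmin_left by lra.
  + exists (t - s); split; [lra|]; intros u Hu Hus; apply Rabs_def2 in Hus.
    split; trivial; unfold duhamel; now rewrite Rmin_left by lra.
  + assert (HW := strong_family_fund N).
    replace (minus (fund_sum N (t - s) (minus (dv s) (A0 (v s))))
        (fund_sum N (t - tau - s) (A1 (v s))))
      with (minus (fund_family N (t - s) (dv s))
        (plus (fund_sum N (t - s) (A0 (v s)))
          (fund_sum N (t - s - tau) (A1 (v s))))).
    2:{ rewrite !(fund_sum_family N (t - s)) by lra.
        rewrite (linear_minus (fund_family N (t - s))) by apply (sf_linear _ HW).
        replace (t - tau - s) with (t - s - tau) by ring; module_eq. }
    apply is_derive_within_app; trivial.
    apply (is_derive_shift_loc _ (fun r => fund_sum N r (v s)) (t - s) 0).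
    * exists (t - s); split; [lra|]; intros r Hr; apply Rabs_def2 in Hr.
      rewrite Rminus_0_r; symmetry; apply fund_sum_family; lra.
    * rewrite Rminus_0_r; apply is_derive_fund_sum; trivial; lra.
- rewrite !fund_sum_neg by lra.
  apply (is_derive_within_loc (fun s => a <= s <= b) (fun s => a <= s <= b)
    (fun _ => v t)); trivial.
  + unfold duhamel; rewrite Rmin_right, fund_family_nonpos; trivial; lra.
  + exists (s - t); split; [lra|]; intros u Hu Hus; apply Rabs_def2 in Hus.
    split; trivial; unfold duhamel; rewrite Rmin_right, fund_family_nonpos;
      trivial; lra.
  + apply is_derive_within_of_is_derive; trivial.
    refine (eq_ind _ (is_derive (fun _ => v t) s) (is_derive_const (v t) s) _ _).
    module_eq.
Qed.

(** Real form of [classical_solution]; for [Y = realify X] the two are convertible. *)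
Definition delay_solution (phi v : R -> Y) : Prop :=
  continuous_on (fun t => - tau <= t) v /\
  (exists dv : R -> Y, C1_on (fun t => 0 <= t) v dv /\
     forall t, 0 <= t ->
       D0 (v t) /\ dv t = plus (A0 (v t)) (A1 (v (t - tau)))) /\
  (forall t, - tau <= t <= 0 -> v t = phi t).

Lemma ex_RInt_delayed (N : nat) (v : R -> Y) (t a b : R) :
  continuous_on (fun s => - tau <= s) v -> - tau <= a -> - tau <= b ->
  ex_RInt (fun s => fund_sum N (t - tau - s) (A1 (v s))) a b.
Proof.
intros Hv Ha Hb.
apply (ex_RInt_ext (fun s => if Rle_dec s (t - tau) then
  fund_family N (t - tau - s) (A1 (v (Rmax s (- tau)))) else zero)).
- intros s [Hs _].
  assert (Hs' : - tau < s).
  { eapply Rle_lt_trans; [|exact Hs]; now apply Rmin_glb. }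
  rewrite Rmax_left by lra; destruct Rle_dec.
  + symmetry; apply fund_sum_family; lra.
  + symmetry; apply fund_sum_neg; lra.
- apply (ex_RInt_cut (fun s =>
    fund_family N (t - tau - s) (A1 (v (Rmax s (- tau)))))).
  intros s; apply (strong_family_app _ (fun s => t - tau - s)
    (fun s => A1 (v (Rmax s (- tau)))));
    [apply strong_family_fund|apply continuous_sub_l|].
  exact (continuous_linear A1 _ s HA1 (continuous_clamp_left v (- tau) s Hv)).
Qed.

Lemma RInt_delayed_zero (N : nat) (v : R -> Y) (t a b : R) :
  t - tau <= a <= b ->
  RInt (fun s => fund_sum N (t - tau - s) (A1 (v s))) a b = zero.
Proof.
intros Hab; apply is_RInt_unique, (is_RInt_ext (fun _ => zero)).
- intros s Hs; rewrite Rmin_left, Rmax_right in Hs by lra.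
  symmetry; apply fund_sum_neg; lra.
- refine (eq_ind _ (is_RInt (fun _ => zero) a b) (is_RInt_const a b zero) _ _).
  module_eq.
Qed.

(** By the equation [dv - A0 v] is the delayed term, so [A0] disappears from the derivative and the
    Riemann integral applies. *)
Lemma duhamel_variation (N : nat) (phi v : R -> Y) (t : R) :
  delay_solution phi v -> 0 <= t -> t < INR (S N) * tau ->
  v t = plus (duhamel N v t 0)
    (RInt (fun s => fund_sum N (t - tau - s) (A1 (v s))) (- tau) 0).
Proof.
intros (Hvc & (dv & Hdv & Hv) & _) Ht HN.
set (q := fun s => fund_sum N (t - tau - s) (A1 (v s))).
assert (Hq : forall a b, - tau <= a -> - tau <= b -> ex_RInt q a b)
  by (intros; now apply ex_RInt_delayed).
assert (Hsub : forall s, 0 <= s <= t ->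
  is_derive_within (fun s => 0 <= s <= t) v s (dv s)).
{ intros s Hs; apply (is_derive_within_loc (fun s => 0 <= s)
    (fun s => 0 <= s <= t) v v); trivial; [lra| |apply Hdv; lra].
  exists 1; split; [lra|]; intros u Hu _; split; [lra|easy]. }
assert (Hsh : is_RInt (fun s => q (s + - tau)) 0 t (RInt q (- tau) (t - tau))).
{ apply is_RInt_shift; rewrite Rplus_0_l; apply RInt_correct, Hq; lra. }
assert (Hint : is_RInt (fun s => minus (q (s + - tau)) (q s)) 0 t
  (minus (RInt q (- tau) (t - tau)) (RInt q 0 t))).
{ refine (is_RInt_minus _ _ _ _ _ _ Hsh _); apply RInt_correct, Hq; lra. }
assert (HF : is_RInt (fun s => minus (q (s + - tau)) (q s)) 0 t
  (minus (duhamel N v t t) (duhamel N v t 0))).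
{ apply (is_RInt_derive_within (duhamel N v t)
    (fun s => minus (q (s + - tau)) (q s)) 0 t (jump_times N t)); trivial.
  - apply continuous_on_duhamel; trivial.
    intros s Hs; exact (is_derive_within_continuous _ _ _ _ Hs (Hsub s Hs)).
  - intros s Hs Hj.
    assert (H := is_derive_within_duhamel N v dv 0 t t s Hs
      ltac:(rewrite Rminus_0_r; exact HN) (Hsub s Hs)
      (proj1 (Hv s (proj1 Hs))) Hj).
    replace (minus (q (s + - tau)) (q s)) with
      (minus (fund_sum N (t - s) (minus (dv s) (A0 (v s))))
        (fund_sum N (t - tau - s) (A1 (v s)))); trivial.
    unfold q; rewrite (proj2 (Hv s (proj1 Hs))).
    replace (minus (plus (A0 (v s)) (A1 (v (s - tau)))) (A0 (v s)))
      with (A1 (v (s - tau))) by module_eq.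
    replace (t - tau - (s + - tau)) with (t - s) by ring; reflexivity.
  - eexists; exact Hint. }
assert (E : minus (duhamel N v t t) (duhamel N v t 0) =
  minus (RInt q (- tau) (t - tau)) (RInt q 0 t)).
{ rewrite <- (is_RInt_unique _ _ _ _ Hint); symmetry; now apply is_RInt_unique. }
assert (Et : duhamel N v t t = v t).
{ unfold duhamel; rewrite Rmin_left, fund_family_nonpos; trivial; lra. }
rewrite Et in E.
(* The common part from [0] to [t - tau] cancels and [q] vanishes beyond [t - tau]. Oriented
   integrals cover [t < tau] as well. *)
assert (C1 := RInt_Chasles q (- tau) 0 (t - tau)
  ltac:(apply Hq; lra) ltac:(apply Hq; lra)).
assert (C2 := RInt_Chasles q 0 (t - tau) t
  ltac:(apply Hq; lra) ltac:(apply Hq; lra)).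
assert (C3 : RInt q (t - tau) t = zero) by (apply RInt_delayed_zero; lra).
rewrite C3 in C2.
transitivity (plus (minus (v t) (duhamel N v t 0)) (duhamel N v t 0));
  [module_eq|].
rewrite E, <- C1, <- C2; module_eq.
Qed.

(** Existence of the integral comes from the proof itself: [g - q] is a derivative off the jump
    times and [q] is Riemann integrable, so [g] is their sum. The integral of [q] is then traded for
    [v t] minus the value at [s = 0]. *)
Lemma representation (N : nat) (phi dphi v : R -> Y) (t : R) :
  C1_on (fun t => - tau <= t <= 0) phi dphi ->
  (forall t, - tau <= t <= 0 -> D0 (phi t)) ->
  delay_solution phi v -> - tau <= t -> t + tau < INR (S N) * tau ->
  exists I : Y,
    is_HKInt (fun s => fund_sum N (t - s) (minus (dphi s) (A0 (phi s))))
      (- tau) 0 I /\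
    v t = plus (fund_sum N (t + tau) (phi (- tau))) I.
Proof.
intros Hphi Dphi Hsol Ht HN; destruct (Hsol) as (Hvc & _ & Ev).
set (g := fun s => fund_sum N (t - s) (minus (dphi s) (A0 (phi s)))).
set (q := fun s => fund_sum N (t - tau - s) (A1 (v s))).
assert (Hd : forall s, - tau <= s <= 0 ->
  is_derive_within (fun s => - tau <= s <= 0) v s (dphi s)).
{ intros s Hs; apply (is_derive_within_loc (fun s => - tau <= s <= 0)
    (fun s => - tau <= s <= 0) phi v); trivial.
  - symmetry; now apply Ev.
  - exists 1; split; [lra|]; intros u Hu _; split; [easy|symmetry; now apply Ev].
  - now apply Hphi. }
assert (HF : is_HKInt (fun s => minus (g s) (q s)) (- tau) 0
  (minus (duhamel N v t 0) (duhamel N v t (- tau)))).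
{ apply (is_HKInt_derive (duhamel N v t) (fun s => minus (g s) (q s)) (- tau) 0
    (jump_times N t)); [lra| |].
  - apply continuous_on_duhamel; trivial; [lra|].
    intros s Hs; exact (is_derive_within_continuous _ _ _ _ Hs (Hd s Hs)).
  - intros s Hs Hj; unfold g, q; rewrite <- (Ev s Hs).
    apply (is_derive_within_duhamel N v dphi); trivial; try lra; auto.
    rewrite Ev; auto. }
assert (Hq : is_RInt q (- tau) 0 (RInt q (- tau) 0)).
{ apply RInt_correct, ex_RInt_delayed; trivial; lra. }
exists (plus (minus (duhamel N v t 0) (duhamel N v t (- tau)))
  (RInt q (- tau) 0)); split.
- assert (H := is_HKInt_plus _ _ _ _ _ _ HF (is_HKInt_RInt _ _ _ _ Hq)).
  replace g with (fun s => plus (minus (g s) (q s)) (q s)); [exact H|].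
  apply functional_extensionality; intros s; module_eq.
- assert (E1 : duhamel N v t (- tau) = fund_sum N (t + tau) (phi (- tau))).
  { rewrite fund_sum_family by lra; unfold duhamel.
    rewrite Rmin_left by lra; rewrite Ev by lra; f_equal; ring. }
  assert (E2 : v t = plus (duhamel N v t 0) (RInt q (- tau) 0)).
  { destruct (Rle_dec 0 t) as [H0|H0].
    - apply (duhamel_variation N phi); trivial; lra.
    - unfold q; rewrite RInt_delayed_zero by lra.
      unfold duhamel; rewrite Rmin_right by lra.
      rewrite fund_family_nonpos by lra; module_eq. }
  rewrite E2, E1; module_eq.
Qed.

End Fundamental.

(** * The method of steps *)

Section Steps.

Context {Y : CompleteNormedModule R_AbsRing}.

Lemma C1_on_shift (D : R -> Prop) (f df : R -> Y) (c : R) :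
  C1_on D f df ->
  C1_on (fun t => D (t + c)) (fun t => f (t + c)) (fun t => df (t + c)).
Proof.
intros [Hf Hdf]; split.
- intros t Dt.
  refine (proj2 (is_derive_within_eps (fun t => D (t + c)) _ t _ Dt) _).
  intros eps Heps.
  destruct (proj1 (is_derive_within_eps D _ _ _ Dt) (Hf _ Dt) eps Heps)
    as (d & Hd & Hs).
  exists d; split; trivial; intros s Ds Hst.
  replace (s - t) with (s + c - (t + c)) in * by ring; now apply Hs.
- refine (proj2 (continuous_on_eps (fun t => D (t + c)) (fun t => df (t + c))) _).
  intros t Dt eps Heps.
  destruct (proj1 (continuous_on_eps D _) Hdf _ Dt eps Heps) as (d & Hd & Hs).
  exists d; split; trivial; intros s Ds Hst.
  replace (s - t) with (s + c - (t + c)) in * by ring; now apply Hs.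
Qed.

(** The remainder vanishes whatever [df] is; this covers the degenerate interval [[0, 0]] at the
    start of the method of steps. *)
Lemma C1_on_point (D : R -> Prop) (a : R) (f df : R -> Y) :
  (forall t, D t -> t = a) -> C1_on D f df.
Proof.
intros Ha; split.
- intros t Dt; apply (proj2 (is_derive_within_eps D _ t _ Dt)); intros eps Heps.
  exists 1; split; [lra|]; intros s Ds _.
  rewrite (Ha s Ds), <- (Ha t Dt).
  norm_as (@zero Y) by module_eq.
  norm_zero_eq; apply Rmult_le_pos; [lra|apply Rabs_pos].
- apply continuous_on_eps; intros t Dt eps Heps.
  exists 1; split; [lra|]; intros s Ds _; rewrite (Ha s Ds), <- (Ha t Dt).
  norm_as (@zero Y) by module_eq; now norm_zero_eq.
Qed.

Context (T : R -> Y -> Y) (D0 : Y -> Prop) (A0 : Y -> Y).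
Context (HT : real_semigroup T D0 A0).
Context (A1 : Y -> Y) (HA1 : is_linear A1).
Context (tau : R) (Htau : 0 < tau).
Context (phi dphi : R -> Y).
Context (Hphi : C1_on (fun t => - tau <= t <= 0) phi dphi).
Context (Dphi : forall t, - tau <= t <= 0 -> D0 (phi t)).

(** Solution up to time [K tau]. On the next interval the delayed term is known data: with
    [r = t - k tau], the delayed time [t - tau] is [r + (k - 1) tau]. *)
Fixpoint step_solution (K : nat) (t : R) : Y :=
  match K with
  | 0%nat => phi t
  | S k =>
      if Rle_dec t (INR k * tau) then step_solution k t
      else mild T (fun r => A1 (step_solution k (r + (INR k - 1) * tau)))
             (step_solution k (INR k * tau)) (t - INR k * tau)
  end.

Definition delayed_rhs (u : R -> Y) (t : R) : Y :=
  plus (A0 (u t)) (A1 (u (t - tau))).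

(** The forcing of the next step reads only the last interval, whose regularity is recorded
    separately: for [K = 0] it is that of [phi], and a corner of [u] at 0 does no harm. *)
Record step_invariant (K : nat) (u : R -> Y) : Prop := {
  step_initial : forall t, - tau <= t <= 0 -> u t = phi t;
  step_C1 : C1_on (fun t => 0 <= t <= INR K * tau) u (delayed_rhs u);
  step_domain : forall t, 0 <= t <= INR K * tau -> D0 (u t);
  step_last : exists du,
    C1_on (fun t => (INR K - 1) * tau <= t <= INR K * tau) u du }.

Lemma step_solution_invariant (K : nat) : step_invariant K (step_solution K).
Proof.
induction K as [|k IH].
- split; cbn [step_solution INR]; trivial.
  + apply (C1_on_point _ 0); intros t Ht; lra.
  + intros t Ht; apply Dphi; lra.
  + exists dphi; apply (C1_on_ext (fun t => - tau <= t <= 0) _ phi dphi); trivial.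
    intros t Ht; split; [lra|easy].
- set (u := step_solution k) in *.
  set (a := INR k * tau).
  assert (Ha : 0 <= a) by (apply Rmult_le_pos; [apply pos_INR|lra]).
  assert (EK : INR (S k) * tau = a + tau) by (rewrite S_INR; unfold a; ring).
  assert (EK' : (INR (S k) - 1) * tau = a) by (rewrite S_INR; unfold a; ring).
  assert (Ea : (INR k - 1) * tau = a - tau) by (unfold a; ring).
  destruct IH as [Hini HC1 Hdom [du Hlast]]; fold a in HC1, Hdom, Hlast.
  rewrite Ea in Hlast.
  set (f := fun r => A1 (u (r + (a - tau)))).
  destruct (mild_classical T D0 A0 HT (u a) f (fun r => A1 (du (r + (a - tau)))) tau)
    as (HmC1 & HmD & Hm0); [lra|apply Hdom; lra| |].
  { apply (C1_on_linear A1 _ (fun r => u (r + (a - tau)))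
      (fun r => du (r + (a - tau)))); trivial.
    apply (C1_on_ext (fun t => a - tau <= t + (a - tau) <= a) _
      (fun r => u (r + (a - tau))) (fun r => du (r + (a - tau)))).
    - intros t Ht; split; [lra|easy].
    - exact (C1_on_shift (fun t => a - tau <= t <= a) u du (a - tau) Hlast). }
  set (m := mild T f (u a)) in *.
  set (w := step_solution (S k)).
  assert (Ew : forall t, w t = if Rle_dec t a then u t else m (t - a)).
  { intros t; unfold w; cbn [step_solution]; fold u a.
    rewrite Ea; reflexivity. }
  assert (Ewl : forall t, t <= a -> w t = u t).
  { intros t Ht; rewrite Ew; destruct Rle_dec; [easy|lra]. }
  assert (Ewr : forall t, a <= t -> w t = m (t - a)).
  { intros t Ht; rewrite Ew; destruct Rle_dec; [|easy].
    replace t with a by lra; now rewrite Rminus_diag, Hm0. }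
  (* Serves twice: as the right piece of the gluing at [a], and as the regularity on the last
     interval handed to the next step. *)
  assert (Hr : C1_on (fun t => a <= t <= a + tau) w (delayed_rhs w)).
  { apply (C1_on_ext (fun t => 0 <= t + - a <= tau) _ (fun t => m (t + - a))
      (fun t => plus (A0 (m (t + - a))) (f (t + - a)))).
    - intros t Ht; split; [lra|split].
      + symmetry; apply Ewr; lra.
      + unfold delayed_rhs; rewrite Ewr, (Ewl (t - tau)) by lra.
        unfold f; do 3 f_equal; ring.
    - exact (C1_on_shift (fun t => 0 <= t <= tau) m
        (fun t => plus (A0 (m t)) (f t)) (- a) HmC1). }
  split.
  + intros t Ht; rewrite Ewl by lra; now apply Hini.
  + rewrite EK; apply (C1_on_glue _ a).
    * apply (C1_on_ext (fun t => 0 <= t <= a) _ u (delayed_rhs u)); trivial.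
      intros t [Ht Hta]; split; [lra|]; unfold delayed_rhs.
      now rewrite !Ewl by lra.
    * apply (C1_on_ext (fun t => a <= t <= a + tau) _ w (delayed_rhs w)); trivial.
      intros t [Ht Hta]; split; [lra|easy].
  + rewrite EK; intros t Ht; destruct (Rle_dec t a) as [Hle|Hgt].
    * rewrite Ewl by trivial; apply Hdom; lra.
    * rewrite Ewr by lra; apply HmD; lra.
  + rewrite EK, EK'; now exists (delayed_rhs w).
Qed.

Lemma step_solution_agree (K M : nat) (t : R) :
  (K <= M)%nat -> t <= INR K * tau -> step_solution M t = step_solution K t.
Proof.
intros HKM Ht; induction HKM as [|M HKM IH]; [easy|].
rewrite <- IH; cbn [step_solution]; destruct Rle_dec as [|Hn]; [easy|].
exfalso; apply Hn; apply Rle_trans with (INR K * tau); trivial.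
apply Rmult_le_compat_r; [lra|now apply le_INR].
Qed.

(** [up] exceeds its argument, so the selected step reaches [t]; negative integers are truncated to
    step 0, which is [phi]. *)
Definition delay_flow (t : R) : Y := step_solution (Z.to_nat (up (t / tau))) t.

Lemma delay_flow_step (K : nat) (t : R) :
  t <= INR K * tau -> delay_flow t = step_solution K t.
Proof.
intros Ht; unfold delay_flow; set (M := Z.to_nat (up (t / tau))).
assert (HM : t <= INR M * tau).
{ assert (t / tau <= INR M).
  { unfold M; destruct (archimed (t / tau)) as [Hu _].
    destruct (Z.le_gt_cases 0 (up (t / tau))) as [Hz|Hz].
    - rewrite INR_IZR_INZ, Z2Nat.id by trivial; lra.
    - assert (IZR (up (t / tau)) <= 0) by (apply IZR_le; lia).
      assert (Hp := pos_INR (Z.to_nat (up (t / tau)))); lra. }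
  replace t with (t / tau * tau) by (field; lra).
  apply Rmult_le_compat_r; lra. }
destruct (Nat.le_ge_cases K M).
- now apply step_solution_agree.
- symmetry; now apply step_solution_agree.
Qed.

Lemma exists_step (t : R) : exists K, t < INR K * tau.
Proof.
destruct (INR_unbounded (t / tau)) as [K HK]; exists K.
apply (Rmult_lt_compat_r tau) in HK; trivial.
now replace (t / tau * tau) with t in HK by (field; lra).
Qed.

Lemma delay_flow_initial (t : R) : - tau <= t <= 0 -> delay_flow t = phi t.
Proof. intros Ht; apply (delay_flow_step 0); cbn; lra. Qed.

Lemma delay_flow_domain (t : R) : 0 <= t -> D0 (delay_flow t).
Proof.
intros Ht; destruct (exists_step t) as [K HK].
rewrite (delay_flow_step K) by lra.
apply (step_domain _ _ (step_solution_invariant K)); lra.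
Qed.

Lemma delay_flow_C1 :
  C1_on (fun t => 0 <= t) delay_flow (delayed_rhs delay_flow).
Proof.
assert (E : forall K s, s <= INR K * tau ->
  step_solution K s = delay_flow s /\
  delayed_rhs (step_solution K) s = delayed_rhs delay_flow s).
{ intros K s Hs; unfold delayed_rhs.
  now rewrite !(delay_flow_step K) by lra. }
split; intros t Ht; destruct (exists_step t) as [K HK];
  destruct (E K t ltac:(lra)) as [E1 E2];
  assert (HC := step_C1 _ _ (step_solution_invariant K)).
- rewrite <- E2; apply (is_derive_within_loc (fun t => 0 <= t <= INR K * tau)
    (fun t => 0 <= t) (step_solution K)); trivial; [lra| |apply HC; lra].
  exists (INR K * tau - t); split; [lra|]; intros s Hs Hst.
  apply Rabs_def2 in Hst; split; [lra|apply E; lra].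
- apply (continuous_on_loc (fun t => 0 <= t <= INR K * tau)
    (fun t => 0 <= t) (delayed_rhs (step_solution K))); trivial; [|apply HC; lra].
  exists (INR K * tau - t); split; [lra|]; intros s Hs Hst.
  apply Rabs_def2 in Hst; split; [lra|apply E; lra].
Qed.

Lemma delay_flow_initial_C1 :
  C1_on (fun t => - tau <= t <= 0) delay_flow dphi.
Proof.
apply (C1_on_ext (fun t => - tau <= t <= 0) _ phi dphi); trivial.
intros t Ht; repeat split; try lra; symmetry; now apply delay_flow_initial.
Qed.

Lemma delay_flow_solution : delay_solution D0 A0 A1 tau phi delay_flow.
Proof.
split; [|split].
- refine (continuous_on_glue (fun t => - tau <= t) 0 delay_flow _ _);
    intros t [Ht Ht0].
  + apply (continuous_on_loc (fun t => - tau <= t <= 0) _ delay_flow); trivial.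
    * exists 1; split; [lra|]; intros s Hs _; split; [lra|easy].
    * apply (C1_on_continuous_on _ _ _ delay_flow_initial_C1); lra.
  + apply (continuous_on_loc (fun t => 0 <= t) _ delay_flow); trivial.
    * exists 1; split; [lra|]; intros s Hs _; split; [lra|easy].
    * now apply (C1_on_continuous_on _ _ _ delay_flow_C1).
- exists (delayed_rhs delay_flow); split; [exact delay_flow_C1|].
  intros t Ht; split; [now apply delay_flow_domain|easy].
- exact delay_flow_initial.
Qed.

(** At 0 the left derivative is [dphi 0] and the right one is the right side of the equation. A
    derivative on [[-tau, oo)] must equal both; if they agree, the two C^1 pieces glue. *)
Lemma delay_flow_C1_iff :
  (exists du, C1_on (fun t => - tau <= t) delay_flow du) <->
  dphi 0 = plus (A0 (phi 0)) (A1 (phi (- tau))).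
Proof.
assert (E0 : delayed_rhs delay_flow 0 = plus (A0 (phi 0)) (A1 (phi (- tau)))).
{ unfold delayed_rhs; rewrite !delay_flow_initial by lra.
  now replace (0 - tau) with (- tau) by ring. }
split.
- intros [du [Hdu _]]; specialize (Hdu 0 ltac:(lra)).
  transitivity (du 0); [|rewrite <- E0].
  + apply (is_derive_within_unique (fun t => - tau <= t <= 0) delay_flow 0);
      [lra| |apply delay_flow_initial_C1; lra|].
    * intros d Hd; exists (- Rmin (d / 2) tau).
      assert (Hm := Rmin_l (d / 2) tau); assert (Hm' := Rmin_r (d / 2) tau).
      assert (Hm0 : 0 < Rmin (d / 2) tau) by (apply Rmin_pos; lra).
      repeat split; try lra; apply Rabs_def1; lra.
    * apply (is_derive_within_loc (fun t => - tau <= t) _ delay_flow); trivial;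
        try lra.
      exists 1; split; [lra|]; intros s Hs _; split; [lra|easy].
  + apply (is_derive_within_unique (fun t => 0 <= t) delay_flow 0);
      [lra| | |apply delay_flow_C1; lra].
    * intros d Hd; exists (d / 2).
      repeat split; try lra; apply Rabs_def1; lra.
    * apply (is_derive_within_loc (fun t => - tau <= t) _ delay_flow); trivial;
        try lra.
      exists 1; split; [lra|]; intros s Hs _; split; [lra|easy].
- intros Hc; exists (fun t => if Rle_dec t 0 then dphi t
    else delayed_rhs delay_flow t).
  apply (C1_on_glue _ 0).
  + apply (C1_on_ext (fun t => - tau <= t <= 0) _ delay_flow dphi);
      [|exact delay_flow_initial_C1].
    intros t Ht; destruct Rle_dec; [|lra]; repeat split; lra.
  + apply (C1_on_ext (fun t => 0 <= t) _ delay_flow (delayed_rhs delay_flow));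
      [|exact delay_flow_C1].
    intros t Ht; destruct Rle_dec; repeat split; try lra.
    replace t with 0 by lra; congruence.
Qed.

End Steps.

(** * Complex Banach spaces *)

Section Realified.

Context {X : CompleteNormedModule C_AbsRing}.

Lemma is_linear_realify (L : X -> X) :
  is_linear L -> @is_linear R_AbsRing (realify X) (realify X) L.
Proof.
intros HL; split.
- exact (linear_plus _ HL).
- intros r x; exact (linear_scal _ HL (RtoC r) x).
- exact (linear_norm _ HL).
Qed.

Context (T : R -> X -> X) (D0 : X -> Prop) (A0 : X -> X).
Context (HT : is_C0_semigroup T) (HA0 : is_generator T D0 A0).

Lemma real_semigroup_realify : @real_semigroup (realify X) T D0 A0.
Proof.
destruct HT as (H1 & H2 & H3 & H4); split; trivial.
intros t Ht; now apply is_linear_realify, H1.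
Qed.

Context (A1 : X -> X) (HA1 : is_linear A1) (tau : R) (Htau : 0 < tau).

(** The reflection [s -> t - s] turns the defining integral into a convolution over [[0, r]]; the
    inner term, taken at [s - tau], has shifted argument [s - tau - n tau = r - (t - s)]. *)
Lemma fund_term_dyson (n : nat) (t : R) (x : X) : INR n * tau <= t ->
  fund_term T A1 tau n t x = dyson (Y := realify X) T A1 n (t - INR n * tau) x.
Proof.
revert t; induction n as [|n IH]; intros t Ht.
- cbn in *; rewrite Rmult_0_l in *; rewrite Rminus_0_r.
  symmetry; now apply (orbit_family_pos (Y := realify X)).
- assert (HT' := real_semigroup_realify).
  assert (HO := strong_family_orbit (Y := realify X) T D0 A0 HT').
  assert (HV := strong_family_dyson (Y := realify X) T D0 A0 HT' A1
    (is_linear_realify A1 HA1) n).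
  set (r := t - INR (S n) * tau).
  cbn [fund_term dyson]; rewrite (Rmax_left r 0) by (unfold r; lra).
  apply (is_RInt_unique (V := realify X)).
  set (k := fun y => A1 (dyson (Y := realify X) T A1 n y x)).
  assert (Hk : forall y, continuous (U := realify X) k y).
  { intros y; refine (continuous_linear (Y := realify X) A1 _ y
      (is_linear_realify A1 HA1) _).
    exact (sf_continuous (Y := realify X) _ HV x y). }
  assert (HI := is_RInt_conv (Y := realify X) _ k r HO Hk).
  set (g := fun s => orbit_family (Y := realify X) T s (k (r - s))) in HI.
  apply (is_RInt_ext (V := realify X) (fun s => g (t - s))).
  + intros s Hs; rewrite Rmin_left, Rmax_right in Hs by lra.
    unfold g; rewrite (orbit_family_pos (Y := realify X)) by lra.
    f_equal; unfold k; rewrite IH by (rewrite S_INR in Hs; lra).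
    do 2 f_equal; unfold r; rewrite S_INR; ring.
  + apply (is_RInt_reflect (Y := realify X)).
    replace (t - t) with 0 by ring; exact HI.
Qed.

(** Terms beyond [N] have not started at [r], so the partial sums are constant from [N] on and
    [iota] returns their limit. *)
Lemma fund_sol_sum (N : nat) (r : R) (x : X) : r < INR (S N) * tau ->
  fund_sol T A1 tau r x = fund_sum (Y := realify X) T A1 tau N r x.
Proof.
intros HN; unfold fund_sol; destruct (Rlt_dec r 0) as [Hr|Hr].
- symmetry; now apply (fund_sum_neg (Y := realify X)).
- set (a := fun n => if Rle_dec (INR n * tau) r
    then fund_term T A1 tau n r x else zero).
  assert (Ea : forall n, a n = cut_dyson (Y := realify X) T A1 tau n r x).
  { intros n; unfold a, cut_dyson; destruct Rle_dec; [|easy].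
    now apply fund_term_dyson. }
  apply (iota_filterlim_locally (F := eventually) (sum_n a)).
  apply (filterlim_ext_loc (fun _ => fund_sum (Y := realify X) T A1 tau N r x));
    [|apply filterlim_const].
  exists N; intros n Hn; symmetry.
  change (sum_n (G := realify X) a n = fund_sum (Y := realify X) T A1 tau N r x).
  induction Hn as [|n Hn IH].
  + unfold fund_sum; apply sum_n_ext; intros n; apply Ea.
  + rewrite sum_Sn, IH, Ea.
    rewrite (cut_dyson_neg (Y := realify X)); [apply plus_zero_r|].
    eapply Rlt_le_trans; [exact HN|].
    apply Rmult_le_compat_r; [lra|apply le_INR; lia].
Qed.

End Realified.

(** Being C^1 across 0 is a compatibility condition on the data, stated as an equivalence; existence
    of the integral is part of the conclusion. *)
Theorem theorem11 (X : CompleteNormedModule C_AbsRing) (tau : R)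
    (T : R -> X -> X) (D0 : X -> Prop) (A0 A1 : X -> X) (phi dphi : R -> X)
    (Htau : 0 < tau)
    (HT : is_C0_semigroup T)
    (HA0 : is_generator T D0 A0)
    (HA1 : is_linear A1)
    (Hphi : C1_on (V := realify X) (fun t => - tau <= t <= 0) phi dphi)
    (HphiD : forall t, - tau <= t <= 0 -> D0 (phi t)) :
  exists u0 : R -> X,
    classical_solution D0 A0 A1 tau phi u0 /\
    (forall v : R -> X, classical_solution D0 A0 A1 tau phi v ->
       forall t, - tau <= t -> v t = u0 t) /\
    ((exists du0 : R -> X,
        C1_on (V := realify X) (fun t => - tau <= t) u0 du0) <->
     dphi 0 = plus (A0 (phi 0)) (A1 (phi (- tau)))) /\
    (forall t, 0 <= t -> D0 (u0 t)) /\
    (forall t, - tau <= t ->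
       exists I : X,
         is_HKInt (V := realify X)
           (fun s => fund_sol T A1 tau (t - s) (minus (dphi s) (A0 (phi s))))
           (- tau) 0 I /\
         u0 t = plus (fund_sol T A1 tau (t + tau) (phi (- tau))) I).
Proof.
assert (HT' := real_semigroup_realify T D0 A0 HT HA0).
assert (HA1' := is_linear_realify A1 HA1).
set (u0 := delay_flow (Y := realify X) T A1 tau phi).
assert (Hsol : classical_solution D0 A0 A1 tau phi u0)
  by exact (delay_flow_solution (Y := realify X) T D0 A0 HT' A1 HA1' tau Htau
      phi dphi Hphi HphiD).
assert (Hrep : forall v, classical_solution D0 A0 A1 tau phi v ->
  forall t, - tau <= t -> exists I : X,
    is_HKInt (V := realify X)
      (fun s => fund_sol T A1 tau (t - s) (minus (dphi s) (A0 (phi s))))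
      (- tau) 0 I /\
    v t = plus (fund_sol T A1 tau (t + tau) (phi (- tau))) I).
{ intros v Hv t Ht.
  (* One truncation serves the whole formula, because [t - s <= t + tau] for [s] in [[-tau, 0]]. *)
  destruct (exists_step tau Htau (t + tau)) as [N HN].
  assert (HN' : t + tau < INR (S N) * tau) by (rewrite S_INR; lra).
  destruct (representation (Y := realify X) T D0 A0 HT' A1 HA1' tau Htau N
    phi dphi v t Hphi HphiD Hv Ht HN') as (I & HI & EI).
  assert (E := fund_sol_sum T D0 A0 HT HA0 A1 HA1 tau Htau N).
  exists I; split; [|now rewrite E].
  refine (is_HKInt_ext (V := realify X) _ _ _ _ _ _ HI).
  intros s Hs; rewrite Rmin_left, Rmax_right in Hs by lra.
  symmetry; apply E; lra. }
exists u0; split; [exact Hsol|split; [|split; [|split]]].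
- intros v Hv t Ht.
  destruct (Hrep v Hv t Ht) as (I & HI & ->).
  destruct (Hrep u0 Hsol t Ht) as (J & HJ & ->).
  f_equal; exact (is_HKInt_unique _ _ _ _ _ HI HJ).
- exact (delay_flow_C1_iff (Y := realify X) T D0 A0 HT' A1 HA1' tau Htau
    phi dphi Hphi HphiD).
- exact (delay_flow_domain (Y := realify X) T D0 A0 HT' A1 HA1' tau Htau
    phi dphi Hphi HphiD).
- now apply Hrep.
Qed.
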